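(* Let $\{f(y\mid\theta):\theta\in\Omega\}$ be a family of densities with respect to a measure $\mu$, where $\Omega$ is a metric space, and suppose: (A1) $\Omega$ is compact. (A2) With $h(y)=\sup_{\theta\in\Omega}|\log f(y\mid\theta)|$, one has $\sup_{\theta\in\Omega}E_\theta h^4(Y)<\infty$. (A3) The functions $\theta\mapsto f(y_0\mid\theta)$ are uniformly bounded, and continuous in $\theta$ for every $y_0$. (A4) The class of mixture densities $\{f_G\}$, $G$ ranging over all probability distributions on $\Omega$, is identifiable: $f_G=f_{\tilde G}$ ($\mu$-a.e.) implies $G=\tilde G$. (A5) For every probability distribution $G_0$ on $\Omega$, every $\epsilon>0$ and every $M>0$, the set $\{G:\ \|\log(f_G^{(M)})-\log(f_{G_0}^{(M)})\|_\infty<\epsilon\}$ of probability distributions on $\Omega$ is open in the topology of weak convergence, where $f_G^{(M)}(y)=[f_G(y)]_M$ and $[x]_M=\max(-M,\min(x,M))$. For each $n$ let $\theta_1^n,\dots,\theta_n^n\in\Omega$ be fixed (non-random) parameters, let $G^n$ be their empirical distribution, let $Y_1^n,\dots,Y_n^n$ be independent with $Y_i^n\sim f(\cdot\mid\theta_i^n)$ (all rows being defined on a common probability space), and let $\hat G^n$ be a GMLE based on $Y_1^n,\dots,Y_n^n$. Then for every bounded continuous function $g:\Omega\to\mathbb R$, $$\int g\,d\hat G^n-\int g\,dG^n\longrightarrow 0\quad\text{almost surely as } n\to\infty .$$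
   Context: For a probability distribution $G$ on $\Omega$, $f_G(y)=\int f(y\mid\vartheta)\,dG(\vartheta)$. $E_\theta$ denotes expectation when $Y\sim f(\cdot\mid\theta)$. GMLE (generalized maximum likelihood estimator): any probability distribution $\hat G^n$ on $\Omega$ that maximizes $\prod_{i=1}^n f_G(Y_i^n)$ over all probability distributions $G$ on $\Omega$ (that is, the maximizer obtained by treating the observations as if they were i.i.d. from a mixture $f_G$). The empirical distribution of $\theta^n_1,\dots,\theta^n_n$ is $G^n=\frac1n\sum_{i=1}^n\delta_{\theta_i^n}$. *)

(* Defs.v *)
From HB Require Import structures.
From mathcomp Require Import all_boot all_order all_algebra.
From mathcomp Require Import all_classical all_reals all_analysis.

Set Implicit Arguments.
Unset Strict Implicit.
Unset Printing Implicit Defensive.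

Import Order.TTheory GRing.Theory Num.Theory.
Import numFieldNormedType.Exports.

Local Open Scope classical_set_scope.
Local Open Scope ring_scope.

(* Nonempty metric spaces: measurable types are pointed in the library. *)
#[short(type="pmetricType")]
HB.structure Definition PointedMetric (K : numDomainType) :=
  {M of Metric K M & Pointed M}.

Definition borel (T : ptopologicalType) : measurableType (@open T).-sigma :=
  g_sigma_algebraType (@open T).

Section weak_convergence.
Context {R : realType} (Omega : pmetricType R).

Definition bounded_continuous : set (Omega -> R) :=
  [set g | bounded_fun g /\ continuous g].

Definition weak_probability : Type := probability (borel Omega) R.

HB.instance Definition _ := Choice.on weak_probability.

(* Coarsest topology making G |-> \int[G]_t g t continuous for every bounded
   continuous g. *)
HB.instance Definition _ := Topological.copy weak_probability
  (sup_topology (fun g : {g | bounded_continuous g} =>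
     Topological.class (initial_topology
       (fun G : weak_probability => \int[G]_t (sval g t))))).

End weak_convergence.

Section empirical.
Context {R : realType} (Omega : pmetricType R).
Variables (n : nat) (theta : 'I_n -> Omega).
Local Open Scope ereal_scope.

(* The zero measure when n = 0. *)
Definition empirical (A : set (borel Omega)) : \bar R :=
  (n%:R^-1)%:E * \sum_(i < n) dirac (theta i : borel Omega) A.

Let invn_ge0 : (0 <= n%:R^-1 :> R)%R.
Proof. by rewrite invr_ge0. Qed.

Let empiricalE : empirical = mscale (NngNum invn_ge0)
  (msum (fun k => @dirac _ (borel Omega) (nth point (codom theta) k) R) n).
Proof.
apply/funext => A; congr (_ * _); apply: eq_bigr => i _.
by rewrite codomE (nth_map i) ?size_enum_ord// nth_ord_enum.
Qed.

Let empirical0 : empirical set0 = 0.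
Proof. by rewrite empiricalE measure0. Qed.

Let empirical_ge0 A : 0 <= empirical A.
Proof. by rewrite empiricalE measure_ge0. Qed.

Let empirical_sigma_additive : semi_sigma_additive empirical.
Proof. by rewrite empiricalE; exact: measure_semi_sigma_additive. Qed.

HB.instance Definition _ := isMeasure.Build _ (borel Omega) R empirical
  empirical0 empirical_ge0 empirical_sigma_additive.

End empirical.

Section mixtures.
Context {R : realType} (Omega : pmetricType R) {d} (T : measurableType d).
Variables (mu : {measure set T -> \bar R}) (f : Omega -> T -> R).

Definition density_family : Prop := forall t,
  [/\ measurable_fun setT (f t), (forall y, 0 <= f t y) &
      (\int[mu]_y (f t y)%:E = 1)%E].

Definition mixture (G : probability (borel Omega) R) (y : T) : R :=
  \int[G]_t f t y.

(* E_t phi(Y) for Y with density f t *)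
Definition dens_expectation (t : Omega) (phi : T -> \bar R) : \bar R :=
  (\int[mu]_y (phi y * (f t y)%:E))%E.

(* lne is the extended logarithm, with lne 0 = -oo. *)
Definition sup_abs_log (y : T) : \bar R :=
  ereal_sup [set `|lne (f t y)%:E|%E | t in [set: Omega]].

Definition identifiable : Prop := forall G G' : probability (borel Omega) R,
  {ae mu, forall y, mixture G y = mixture G' y} ->
  forall A, measurable A -> G A = G' A.

Definition is_gmle n (y : 'I_n -> T) (G : probability (borel Omega) R) : Prop :=
  forall G' : probability (borel Omega) R,
    \prod_(i < n) mixture G' (y i) <= \prod_(i < n) mixture G (y i).

End mixtures.

Definition trunc {R : realType} (M x : R) : R := Num.max (- M) (Num.min x M).

(* |log a - log b| for a, b >= 0; the test makes log 0 - log 0 equal to 0, since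
   -oo - -oo is -oo in \bar R. *)
Definition log_dist {R : realType} (a b : R) : \bar R :=
  if a == b then 0%E else `|lne a%:E - lne b%:E|%E.

Definition mutually_independent {R : realType} {d d'} {S : measurableType d}
    {T : measurableType d'} (P : probability S R) (I : finType)
    (X : I -> {RV P >-> T}) : Prop :=
  forall (J : {set I}) (A : I -> set T), (forall i, measurable (A i)) ->
    P (\bigcap_(i in [set` J]) X i @^-1` A i) =
    (\prod_(i in J) P (X i @^-1` A i))%E.

(* Main.v *)
(* Let rho(G, G') be the integral of sqrt (f_G f_G'), and G_n the empirical
   distribution of the parameters. Three facts are combined.
   (1) By (A5) applied to Dirac masses, Omega is a finite union of cells on which
   the densities agree up to a factor e^eps outside a null set; rounding up the
   weights of the cells yields finitely many distributions H_1, .., H_J such that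
   every f_G is at most e^(2 eps) f_(H_j) outside one null set, for some H_j
   close to G.
   (2) By (A5), rho is upper semicontinuous, and by (A4) rho(G, G') < 1 when
   G <> G'. As the probabilities on Omega form a weakly compact set, rho is at
   most q < 1 on the pairs with |int g dG - int g dG'| >= eta.
   (3) If the maximizer lies near H_j, then prod_i e^(2 eps) f_(H_j)/f_(G_n) is at
   least 1 at the observations. The expectation of the square root of this
   product factorizes, and by AM-GM it is at most (e^eps rho(H_j, G_n))^n, since
   the mean of the densities of the Y_i is f_(G_n). By Markov and Borel-Cantelli
   a fixed distance between the two integrals of g eventually does not occur. *)

Require Import Defs.
From HB Require Import structures.
From mathcomp Require Import all_boot all_order all_algebra.
From mathcomp Require Import finmap.
From mathcomp Require Import all_classical all_reals all_analysis.
From mathcomp Require Import measurable_realfun ess_sup_inf.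
From mathcomp Require Import ring lra.
Import Order.TTheory GRing.Theory Num.Theory.
Import numFieldNormedType.Exports.
Local Open Scope classical_set_scope.
Local Open Scope ring_scope.

Set Implicit Arguments.
Unset Strict Implicit.
Unset Printing Implicit Defensive.

(** * Limits of ultrafilters of probability measures *)

Lemma ultra_fmap (X Z : Type) (F : set_system X) (f : X -> Z) :
  UltraFilter F -> UltraFilter (f @ F).
Proof.
move=> UF; split; first exact: fmap_proper_filter.
move=> G PG FG; apply/seteqP; split => // B GB.
have [//|FC] := in_ultra_setVsetC (f @^-1` B) UF.
have GC : G (~` B) by apply: FG; rewrite /nbhs /= preimage_setC.
by have [x []] := filter_ex (filterI GB GC).
Qed.

(** Compactness of [[-M, M]] supplies the limit, so every bounded functional of a probability has a
    limit along an ultrafilter. *)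
Lemma ultra_bounded_cvg (R : realType) (X : Type) (F : set_system X)
    (f : X -> R) (M : R) :
  UltraFilter F -> (forall x, `|f x| <= M) -> cvg (f @ F).
Proof.
move=> UF fM; have := @segment_compact R (- M) M; rewrite compact_ultra => cptM.
have [|l [_ fl]] := cptM (f @ F) (ultra_fmap f UF).
  by apply: (@filterE _ F) => x; rewrite /= in_itv /= -ler_norml fM.
by apply/cvg_ex; exists l.
Qed.

Lemma borel_continuous_measurable (R : realType) (T : ptopologicalType)
    (f : T -> R) :
  continuous f -> measurable_fun [set: borel T] f.
Proof.
move=> /continuousP cf; apply: (measurability _ (RGenOpens.measurableE R)).
move=> _ [_ [a [b ->] <-]]; rewrite setTI.
by apply: sub_sigma_algebra; exact/cf/interval_open.
Qed.

Lemma borel_open (T : ptopologicalType) (A : set T) :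
  open A -> measurable (A : set (borel T)).
Proof. exact: sub_sigma_algebra. Qed.

Lemma borel_closed (T : ptopologicalType) (A : set T) :
  closed A -> measurable (A : set (borel T)).
Proof.
move=> cA; rewrite -[A]setCK; apply: (@measurableC _ (borel T)).
by apply: borel_open; apply: closed_openC.
Qed.

Lemma bounded_integrable (R : realType) d (T : measurableType d)
    (P : {finite_measure set T -> \bar R}) (f : T -> R) (M : R) :
  measurable_fun setT f -> (forall x, `|f x| <= M) ->
  P.-integrable setT (EFin \o f).
Proof.
move=> mf fM; apply: measurable_bounded_integrable => //.
  by rewrite -ge0_fin_numE// fin_num_measure.
exists M; split; first exact: num_real.
by move=> N MN x _ /=; rewrite (le_trans (fM x))// ltW.
Qed.

Lemma bounded_fun_bound (R : realType) (T : Type) (g : T -> R) :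
  bounded_fun g -> exists M, forall t, `|g t| <= M.
Proof.
by move=> [M [_ gM]]; exists (M + 1) => t; apply: (gM (M + 1)) => //;
  rewrite ltrDl.
Qed.

Lemma metric_ball_open (R : realType) (M : metricType R) (x : M) (r : R) :
  open (ball x r).
Proof.
rewrite openE => y; rewrite ballEmdist /= => xy.
apply/nbhs_ballP; exists (r - mdist x y); first by rewrite /= subr_gt0.
move=> z; rewrite !ballEmdist /= ltrBrDl; apply: le_lt_trans.
exact: metric_triangle.
Qed.

(** * From the limit of the values on sets to a Borel probability *)

Section weak_limit.
Context {R : realType} (Omega : pmetricType R).
Context (F : set_system (weak_probability Omega)) (UF : UltraFilter F).
Hypothesis cptOmega : compact [set: Omega].

Definition limit_content (A : set Omega) : R :=
  lim (fine ((G : probability (borel Omega) R) A) @[G --> F]).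
Local Notation l := limit_content.

Lemma limit_contentE (A : set Omega) : measurable (A : set (borel Omega)) ->
  (fun G : weak_probability Omega => fine ((G :
    probability (borel Omega) R) A)) @ F --> l A.
Proof.
move=> mA; apply: (@ultra_bounded_cvg _ _ F _ 1) => //= G.
rewrite ger0_norm ?fine_ge0// -lee_fin fineK ?fin_num_measure//.
exact: probability_le1.
Qed.

Lemma limit_content0 : l set0 = 0.
Proof.
apply: cvg_lim => //; apply: cvg_near_cst.
by apply: nearW => G; rewrite measure0.
Qed.

Lemma limit_contentT : l setT = 1.
Proof.
apply: cvg_lim => //; apply: cvg_near_cst.
by apply: nearW => G; rewrite probability_setT.
Qed.

Lemma le_limit_content (A B : set Omega) :
  measurable (A : set (borel Omega)) -> measurable (B : set (borel Omega)) ->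
  A `<=` B -> l A <= l B.
Proof.
move=> mA mB AB; rewrite /limit_content; apply: (@ler_lim _ F).
- by apply/cvg_ex; exists (l A); exact: limit_contentE.
- by apply/cvg_ex; exists (l B); exact: limit_contentE.
apply: nearW => G; apply: fine_le; rewrite ?fin_num_measure//.
by apply: le_measure; rewrite ?inE.
Qed.

Lemma limit_contentU (A B : set Omega) :
  measurable (A : set (borel Omega)) -> measurable (B : set (borel Omega)) ->
  A `&` B = set0 -> l (A `|` B) = l A + l B.
Proof.
move=> mA mB AB; apply: cvg_lim => //.
apply: cvg_trans (cvgD (limit_contentE mA) (limit_contentE mB)).
apply: near_eq_cvg; apply: nearW => G /=.
by rewrite measureU// fineD ?fin_num_measure.
Qed.

Lemma limit_content_bigU (A : (set Omega)^nat) n :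
  (forall k, measurable (A k : set (borel Omega))) ->
  l (\big[setU/set0]_(k < n) A k) <= \sum_(k < n) l (A k).
Proof.
move=> mA; elim: n => [|n IH]; first by rewrite !big_ord0 limit_content0.
rewrite !big_ord_recr/=; set U := \big[setU/set0]_(_ < _) _ in IH *.
have mU : measurable (U : set (borel Omega)) by exact: bigsetU_measurable.
have mD : measurable (A n `\` U : set (borel Omega)) by exact: measurableD.
rewrite [U `|` A n](_ : _ = U `|` (A n `\` U));
  last by rewrite setUDr setDv setD0.
rewrite limit_contentU ?setDIK// lerD// le_limit_content//.
Qed.

Local Open Scope ereal_scope.

(* The limit of G(U) along F need not be countably additive; replacing it by its
   inner regularization on open sets repairs this. The value +oo elsewhere
   restricts the covers in mu_ext to open ones. *)
Definition limit_premeasure (U : set (borel Omega)) : \bar R :=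
  if `[< open (U : set Omega) >] then
    ereal_sup [set (l C)%:E | C in [set C : set Omega | closed C /\ C `<=` U]]
  else +oo.
Local Notation p := limit_premeasure.

Lemma limit_premeasure_le (U : set Omega) x : open U ->
  (forall C : set Omega, closed C -> C `<=` U -> (l C)%:E <= x) -> p U <= x.
Proof.
move=> oU Ux; rewrite /limit_premeasure asboolT//.
by apply: ge_ereal_sup => _ [C [cC CU] <-]; exact: Ux.
Qed.

Lemma le_limit_premeasure (C U : set Omega) : closed C -> C `<=` U ->
  (l C)%:E <= p U.
Proof.
move=> cC CU; rewrite /limit_premeasure; case: ifPn => _; last by rewrite leey.
by apply: ereal_sup_ubound; exists C.
Qed.

Lemma limit_premeasure0 : p set0 = 0.
Proof.
apply/eqP; rewrite eq_le; apply/andP; split.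
  apply: (@limit_premeasure_le set0); first exact: open0.
  by move=> C _; rewrite subset0 => ->; rewrite limit_content0.
rewrite -[leLHS]/(0%R%:E) -limit_content0;
  apply: (@le_limit_premeasure set0 set0) => //.
exact: closed0.
Qed.

Lemma limit_premeasure_ge0 (U : set (borel Omega)) : 0 <= p U.
Proof.
rewrite -[leLHS]/(0%R%:E) -limit_content0;
  apply: (@le_limit_premeasure set0) => //.
exact: closed0.
Qed.

Lemma limit_premeasure_content (U : set Omega) : open U -> p U <= (l U)%:E.
Proof.
move=> oU; apply: limit_premeasure_le => // C cC CU; rewrite lee_fin.
apply: le_limit_content => //; first exact: borel_closed.
exact: borel_open.
Qed.

Definition limit_outer : set Omega -> \bar R := mu_ext p.

HB.instance Definition _ := isOuterMeasure.Build R Omega limit_outer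
  (mu_ext0 limit_premeasure0 limit_premeasure_ge0)
  (mu_ext_ge0 limit_premeasure_ge0)
  (le_mu_ext p)
  (mu_ext_sigma_subadditive limit_premeasure_ge0).

Lemma limit_outer_le (U : set Omega) : open U -> limit_outer U <= p U.
Proof.
move=> oU; apply: ereal_inf_lbound;
  exists (fun n => if n is 0%N then U else set0).
  by split=> [[|n]|x Ux]; [exact: borel_open|exact: measurable0|exists 0%N].
rewrite nneseries_recl//; last by move=> *; exact: limit_premeasure_ge0.
rewrite eseries_cond/= eseries0 ?adde0// => -[|]//= k _ _.
exact: limit_premeasure0.
Qed.

(** A closed [C] contained in both [W] and [U], and a closed [D] contained in [W] minus [C], are
    disjoint closed subsets of [W], so [l C + l D] is the content of their union and at most [p W].
    Taking the supremum over [D], then over [C], bounds the two outer measures. *)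
Lemma limit_outer_split (W U : set Omega) : open W -> open U ->
  limit_outer (W `&` U) + limit_outer (W `&` ~` U) <= p W.
Proof.
move=> oW oU.
have oWU : open (W `&` U) by exact: openI.
have pW1 (V : set Omega) : open V -> p V \is a fin_num.
  move=> oV; rewrite ge0_fin_numE ?limit_premeasure_ge0//.
  by rewrite (le_lt_trans (limit_premeasure_content oV)) ?ltry.
have key C : closed C -> C `<=` W `&` U ->
    limit_outer (W `&` ~` U) + (l C)%:E <= p W.
  move=> cC CWU.
  have oWC : open (W `&` ~` C) by apply: openI => //; exact: closed_openC.
  rewrite (@le_trans _ _ (p (W `&` ~` C) + (l C)%:E))//.
    rewrite leeD2r// (le_trans _ (limit_outer_le oWC))//.
    apply: le_outer_measure; apply: setIS; apply: subsetC.
    by move=> x /CWU[].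
  rewrite -leeBrDr//; apply: limit_premeasure_le => // D cD DWC.
  rewrite leeBrDr// -EFinD -limit_contentU;
    [|exact: borel_closed|exact: borel_closed|].
    apply: le_limit_premeasure; first exact: closedU.
    by rewrite subUset; split=> [x /DWC[]//|x /CWU[]].
  by apply/seteqP; split=> // x [/DWC[_]].
(* Finiteness allows this term to be moved across an inequality between extended reals. *)
have outer_fin : limit_outer (W `&` ~` U) \is a fin_num.
  rewrite ge0_fin_numE ?outer_measure_ge0//.
  apply: (@le_lt_trans _ _ (p W));
    last by rewrite -ge0_fin_numE ?pW1// limit_premeasure_ge0.
  by rewrite (le_trans _ (limit_outer_le oW))//; apply: le_outer_measure;
    exact: subIsetl.
rewrite (le_trans (leeD2r _ (limit_outer_le oWU)))//.
rewrite -leeBrDr//; apply: limit_premeasure_le => // C cC CWU.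
by rewrite leeBrDr// addeC; exact: key.
Qed.

(** A cover with a non-open member costs [+oo]. In any other cover each member splits along [U] by
    [limit_outer_split], and the inequalities are summed. *)
Lemma open_caratheodory (U : set Omega) : open U -> limit_outer.-caratheodory U.
Proof.
move=> oU; apply: le_caratheodory_measurable => X.
apply: le_ereal_inf_tmp => _ [B [mB XB] <-].
have [|oB] := pselect (exists i, ~ open (B i : set Omega)).
  move=> [i noB]; rewrite (@eseries_pinfty _ _ _ i) ?leey//.
    by move=> n _; rewrite -ltNye (lt_le_trans _ (limit_premeasure_ge0 _)).
  by rewrite /limit_premeasure asboolF.
have {}oB i : open (B i : set Omega) by apply: contrapT => noB; apply: oB;
  exists i.
have cover_le (V : set Omega) :
    limit_outer (X `&` V) <= \sum_(i <oo) limit_outer (B i `&` V).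
  apply: (@le_trans _ _ (limit_outer (\bigcup_i (B i `&` V)))).
    by apply: le_outer_measure; rewrite -setI_bigcupl; exact: setSI.
  exact: outer_measure_sigma_subadditive.
apply: (le_trans (leeD (cover_le U) (cover_le (~` U)))).
rewrite -nneseriesD//; last 2 first.
  by move=> *; exact: outer_measure_ge0.
  by move=> *; exact: outer_measure_ge0.
apply: lee_nneseries => [n _ _|n _].
  by rewrite adde_ge0// outer_measure_ge0.
exact: limit_outer_split.
Qed.

(** The complement is a union of open balls centred outside [A]. These shrinkings put closed sets
    inside the members of an open cover, and on closed subsets [l] bounds [p] from below. *)
Lemma shrink_closed (A : set Omega) (r : R) :
  closed [set x | ball x r `<=` A].
Proof.
rewrite -[X in closed X]setCK; apply: open_closedC.
rewrite (_ : ~` _ = \bigcup_(z in ~` A) ball z r).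
  by apply: bigcup_open => z _; exact: metric_ball_open.
apply/seteqP; split => [x /existsNP[z /not_implyP[xz Az]]|x [z Az zx] xA].
  by exists z => //; exact: ball_sym.
by apply: Az; apply: xA; exact: ball_sym.
Qed.

(** Only the lower bound needs an idea: by compactness finitely many closed shrinkings of an open
    cover still cover [Omega], and finite subadditivity of [l] gives 1 at most the sum of the
    [p (B k)]. *)
Lemma limit_outerT : limit_outer setT = 1.
Proof.
apply/eqP; rewrite eq_le; apply/andP; split.
  rewrite (le_trans (limit_outer_le openT))//.
  by rewrite (le_trans (limit_premeasure_content openT))// limit_contentT.
apply: le_ereal_inf_tmp => _ [B [mB XB] <-].
have [|oB] := pselect (exists i, ~ open (B i : set Omega)).
  move=> [i noB]; rewrite (@eseries_pinfty _ _ _ i) ?leey//.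
    by move=> n _; rewrite -ltNye (lt_le_trans _ (limit_premeasure_ge0 _)).
  by rewrite /limit_premeasure asboolF.
have {}oB i : open (B i : set Omega) by apply: contrapT => noB; apply: oB;
  exists i.
pose C m k := [set x : Omega | ball x m.+1%:R^-1%R `<=` B k].
(* A Lebesgue number argument: the single integer [m] bounds both the indices used and the inverse
   of the radius. *)
have [m _ Cm] : \forall m \near \oo, forall x : Omega, setT x ->
    exists2 k, (k < m)%N & C m k x.
  move/compact_near_coveringP: cptOmega; apply => x _.
  have [k _ Bkx] := XB x I.
  have [e /= e0 eB] : nbhs_ball (x : Omega) (B k : set Omega).
    by apply/nbhs_ballP; exact: open_nbhs_nbhs.
  have e20 : (0 < e / 2)%R by rewrite divr_gt0.
  exists (ball x (e / 2), [set m | (k < m)%N /\ (m.+1%:R^-1 < e / 2)%R]).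
    split; first exact: nbhsx_ballx.
    near=> m; split; near: m; first exact: nbhs_infty_gt.
    exact: (near_infty_natSinv_lt (PosNum e20)).
  case=> x' m /= [xx' [km me]]; exists k => // z x'z; apply: eB.
  by apply: (@ball_split _ _ x') => //; exact: le_ball (ltW me) _ x'z.
have {}Cm := Cm m (leqnn m).
rewrite -limit_contentT.
rewrite (_ : setT = \big[setU/set0]_(k < m) C m k); last first.
  apply/esym/seteqP; split => // x _; have [k km Cx] := Cm x I.
  by rewrite -bigcup_mkord; exists k.
have cC k : closed (C m k) by exact: shrink_closed.
apply: (@le_trans _ _ (\sum_(k < m) l (C m k))%:E).
  by rewrite lee_fin; apply: limit_content_bigU => k; exact: borel_closed.
rewrite -sumEFin.
apply: (@le_trans _ _ (\sum_(k < m) p (B k))).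
  apply: lee_sum => k _; apply: le_limit_premeasure => // x; apply.
  exact: ballxx.
rewrite -(big_mkord xpredT (fun k => p (B k))).
by apply: nneseries_lim_ge => k _ _; exact: limit_premeasure_ge0.
Unshelve. all: by end_near. Qed.

Lemma borel_caratheodory (A : set (borel Omega)) :
  measurable A -> limit_outer.-caratheodory A.
Proof.
suff : <<s @open Omega >> `<=` limit_outer.-cara.-measurable by exact.
apply: smallest_sub; last by move=> U; exact: open_caratheodory.
split=> [|X mX|X mX]; [exact: measurable0|rewrite setTD; exact: measurableC|].
exact: bigcupT_measurable.
Qed.

(* The two proofs are parameters so that the measure structures below, which
   depend on them, can be inferred. *)
Definition limit_measure (_ : UltraFilter F) (_ : compact [set: Omega])
  (A : set (borel Omega)) : \bar R := limit_outer A.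
Local Notation mu := (limit_measure UF cptOmega).

Let limit_measure0 : mu set0 = 0.
Proof. exact: outer_measure0. Qed.

Let limit_measure_ge0 A : 0 <= mu A.
Proof. exact: outer_measure_ge0. Qed.

Let limit_measure_sigma_additive : semi_sigma_additive mu.
Proof.
move=> A mA tA mUA; apply: (@caratheodory_measure_sigma_additive _ _
  limit_outer) => //.
  by move=> i; exact: borel_caratheodory.
exact: borel_caratheodory.
Qed.

HB.instance Definition _ := isMeasure.Build _ (borel Omega) R mu
  limit_measure0 limit_measure_ge0 limit_measure_sigma_additive.

HB.instance Definition _ := Measure_isProbability.Build _ (borel Omega) R
  mu limit_outerT.

(** One half of the portmanteau criterion. Through superlevel sets it is enough for the convergence
    of integrals. *)
Lemma limit_measure_open (U : set Omega) : open U -> mu U <= (l U)%:E.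
Proof.
move=> oU; rewrite (le_trans (limit_outer_le oU))//.
exact: limit_premeasure_content.
Qed.

End weak_limit.

(** * Compactness of the weak topology *)

Lemma Rintegral_sum (R : realType) d (T : measurableType d)
    (m : {measure set T -> \bar R}) (I : Type) (s : seq I) (f : I -> T -> R) :
  (forall i, m.-integrable setT (EFin \o f i)) ->
  m.-integrable setT (EFin \o (fun x => \sum_(i <- s) f i x)) /\
  \int[m]_x (\sum_(i <- s) f i x) = \sum_(i <- s) \int[m]_x f i x.
Proof.
move=> fi; elim: s => [|i s [IHi IH]].
  rewrite big_nil (_ : (fun x => _) = cst 0); last first.
    by apply/funext => x; rewrite big_nil.
  by split; [exact: integrable0|rewrite Rintegral_cst// mul0r].
rewrite (_ : (fun x => _) = (fun x => f i x + \sum_(j <- s) f j x)); last first.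
  by apply/funext => x; rewrite big_cons.
rewrite big_cons; split; last by rewrite RintegralD// IH.
rewrite (_ : EFin \o _ = (EFin \o f i) \+ (EFin \o (fun x => (\sum_(j <- s) f
  j x)%R)))%E.
  exact: integrableD.
by apply/funext => x.
Qed.

Lemma Rintegral_indicator (R : realType) d (T : measurableType d)
    (m : {finite_measure set T -> \bar R}) (A : set T) : measurable A ->
  \int[m]_x \1_A x = fine (m A).
Proof. by move=> mA; rewrite /Rintegral integral_indic// setIT. Qed.

Lemma integrable_indicator (R : realType) d (T : measurableType d)
    (m : {finite_measure set T -> \bar R}) (A : set T) : measurable A ->
  m.-integrable setT (EFin \o (\1_A : T -> R)).
Proof.
move=> mA; apply: (@bounded_integrable _ _ _ _ _ 1) => [|x];
  first exact: measurable_indic.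
by rewrite indicE; case: (x \in A); rewrite ?normr1 ?normr0.
Qed.

(** A lower approximation of [x] with jumps at the multiples of [e]. The strict comparison makes the
    superlevel sets of a continuous function open, which is where [limit_measure_open] applies. *)
Definition staircase (R : realType) (e : R) (N : nat) (x : R) : R :=
  \sum_(k < N) e * ((k.+1%:R * e < x)%R)%:R.

Lemma staircase_bounds (R : realType) (e : R) (N : nat) (x : R) : 0 < e ->
  0 <= x ->
  x <= N%:R * e -> staircase e N x <= x <= staircase e N x + e.
Proof.
move=> e0 x0 xN; apply/andP; split.
  rewrite /staircase {xN}; elim: N => [|N IH]; first by rewrite big_ord0.
  rewrite big_ord_recr/=; case: ltP => [Nx|_]; last by rewrite mulr0 addr0.
  rewrite mulr1 (le_trans _ (ltW Nx))// -natr1 mulrDl mul1r lerD2r.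
  rewrite mulr_natl -[in leRHS](card_ord N) -sumr_const; apply: ler_sum => i _.
  by rewrite ler_piMr ?(ltW e0)// lern1 leq_b1.
elim: N xN => [|N IH] xN;
  first by rewrite /staircase big_ord0 add0r (le_trans xN)// mul0r ltW.
(* The top step is never reached, as [x] is at most its threshold. *)
rewrite /staircase big_ord_recr/= ltNge xN mulr0 addr0.
have [/IH//|Nx] := leP x (N%:R * e).
rewrite (eq_bigr (fun=> e)) => [|i _]; last first.
  rewrite (le_lt_trans _ Nx) ?mulr1//.
  by rewrite ler_wpM2r ?(ltW e0)// ler_nat.
by rewrite sumr_const card_ord -mulr_natl (le_trans xN)// -natr1 mulrDl mul1r.
Qed.

Section compactness.
Context {R : realType} (Omega : pmetricType R).

Lemma continuous_open_gt (h : Omega -> R) (c : R) : continuous h ->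
  open [set t | c < h t].
Proof.
by move=> /continuousP ch; have := ch _ (@open_gt R c).
Qed.

Lemma Rintegral_staircase (m : {finite_measure set (borel Omega) -> \bar R})
    (h : Omega -> R) (e : R) (N : nat) : continuous h ->
  m.-integrable setT (EFin \o (fun t : borel Omega => staircase e N (h t))) /\
  \int[m]_t staircase e N (h t) =
    \sum_(k < N) e * fine (m [set t | k.+1%:R * e < h t]).
Proof.
move=> ch.
have mA (k : 'I_N) : measurable ([set t | k.+1%:R * e < h t] :
  set (borel Omega)).
  by apply: borel_open; exact: continuous_open_gt.
have iA (k : 'I_N) : m.-integrable setT
    (EFin \o (fun t => e * \1_[set t | k.+1%:R * e < h t] t)).
  apply: (@bounded_integrable _ _ _ _ _ `|e|).
    by apply: measurable_funM => //; exact: measurable_indic.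
  by move=> t; rewrite normrM ler_piMr// indicE; case: (_ \in _);
    rewrite ?normr1 ?normr0.
rewrite (_ : (fun t => staircase e N (h t)) = (fun t =>
    \sum_(k < N) e * \1_[set t | k.+1%:R * e < h t] t)); last first.
  apply/funext => t; apply: eq_bigr => k _; congr (_ * _).
  rewrite indicE; congr (_%:R); congr nat_of_bool.
  by apply/idP/idP; rewrite inE.
have [i1 ->] := Rintegral_sum (index_enum _) iA; split => //.
apply: eq_bigr => k _; rewrite RintegralZl ?Rintegral_indicator//.
exact: integrable_indicator.
Qed.

Lemma continuous_integrable (m : {finite_measure set (borel Omega) -> \bar R})
    (h : Omega -> R) : bounded_continuous h -> m.-integrable setT (EFin \o h).
Proof.
move=> [/bounded_fun_bound[M hM] ch].
by apply: (@bounded_integrable _ _ _ _ _ M) => //;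
  exact: borel_continuous_measurable.
Qed.

Lemma integral_bound (P : probability (borel Omega) R) (h : Omega ->
  R) (M : R) :
  measurable_fun [set: borel Omega] h -> (forall t, `|h t| <= M) ->
  `|\int[P]_t h t| <= M.
Proof.
move=> mh hM; have ih := @bounded_integrable _ _ _ P _ _ mh hM.
rewrite (le_trans (le_normr_Rintegral _ ih))//.
rewrite -[leRHS]mulr1 -[1]/(fine 1%E) -(probability_setT P) -Rintegral_cst//.
apply: le_Rintegral => //.
  apply: (@bounded_integrable _ _ _ _ _ M) => [|x];
    first exact: measurableT_comp.
  by rewrite normr_id.
by apply: (@bounded_integrable _ _ _ _ _ `|M|).
Qed.

Hypothesis cptOmega : compact [set: Omega].
Context (F : set_system (weak_probability Omega)) (UF : UltraFilter F).
Local Notation mu := (limit_measure UF cptOmega).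

(** The staircase of [h] integrates to a finite combination of measures of open superlevel sets.
    There [mu] is at most [l], and the combination of the [l] values is the limit of the staircase
    integrals, hence at most the limit of the integrals of [h]. The staircase loses at most [e]. *)
Lemma le_limit_integral (h : Omega -> R) (B : R) : continuous h ->
  (forall t, 0 <= h t <= B) ->
  \int[mu]_t h t <= lim ((fun G : weak_probability Omega => \int[G]_t h t) @ F).
Proof.
move=> ch hB.
have bch : bounded_continuous h.
  split => //; exists B; split; first exact: num_real.
  by move=> x Bx t _ /=; have /andP[h0 h1] := hB t;
    rewrite ger0_norm// (le_trans h1)// ltW.
apply/ler_addgt0Pr => e e0.
have [N BN] : exists N : nat, B <= N%:R * e.
  exists (Num.truncn (B / e)).+1; rewrite -ler_pdivrMr//.
  by rewrite ltW// truncnS_gt.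
have sh t : staircase e N (h t) <= h t <= staircase e N (h t) + e.
  have /andP[h0 h1] := hB t; apply: staircase_bounds => //.
  exact: le_trans h1 BN.
have [is_ sE] := Rintegral_staircase mu e N ch.
have ie : mu.-integrable setT (EFin \o (fun _ : borel Omega => e)).
  exact: (@bounded_integrable _ _ _ _ _ `|e|).
apply: (@le_trans _ _ (\int[mu]_t (staircase e N (h t) + e))).
  apply: le_Rintegral => //; first exact: continuous_integrable.
    rewrite (_ : EFin \o _ = (EFin \o (fun t => staircase e N (h t))) \+ (EFin
      \o cst e))%E //.
    exact: integrableD.
  by move=> t _; have /andP[] := sh t.
rewrite RintegralD// Rintegral_cst// [X in _ * fine X]probability_setT mulr1
  lerD2r sE.
pose A (k : nat) := [set t : Omega | k.+1%:R * e < h t].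
apply: (@le_trans _ _ (\sum_(k < N) e * limit_content F (A k))).
  apply: ler_sum => k _; rewrite ler_pM2l// -lee_fin fineK ?fin_num_measure//.
    by apply: limit_measure_open; exact: continuous_open_gt.
  by apply: borel_open; exact: continuous_open_gt.
have cs : (fun G : weak_probability Omega => \sum_(k < N) e * fine ((G :
  probability _ _) (A k))) @ F
    --> \sum_(k < N) e * limit_content F (A k).
  apply: cvg_big => [|k _]; first exact: add_continuous.
  apply: cvgMl_tmp; apply: limit_contentE.
  by apply: borel_open; exact: continuous_open_gt.
rewrite -(cvg_lim _ cs)//; apply: ler_lim.
- by apply/cvg_ex; eexists; exact: cs.
- apply: (@ultra_bounded_cvg _ _ F _ B) => // G.
  apply: integral_bound; first exact: borel_continuous_measurable.
  by move=> t; have /andP[h0 h1] := hB t; rewrite ger0_norm.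
apply: nearW => G.
have [isG sEG] := Rintegral_staircase (G : probability _ _) e N ch.
rewrite -sEG; apply: le_Rintegral => //; first exact: continuous_integrable.
by move=> t _; have /andP[] := sh t.
Qed.

(** The one-sided bound, made applicable by adding [M] to reach a nonnegative function, is used for
    [g] and for [- g]; the two inequalities force equality. *)
Lemma limit_integral (g : Omega -> R) : bounded_continuous g ->
  (fun G : weak_probability Omega => \int[G]_t g t) @ F --> \int[mu]_t g t.
Proof.
move=> gbc; have [/bounded_fun_bound[M gM] cg] := gbc.
have cvg_g (h : Omega -> R) (M' : R) : continuous h ->
  (forall t, `|h t| <= M') ->
    cvg ((fun G : weak_probability Omega => \int[G]_t h t) @ F).
  move=> ch hM; apply: (@ultra_bounded_cvg _ _ F _ M') => // G.
  by apply: integral_bound => //; exact: borel_continuous_measurable.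
have shift (c : R) (h : Omega -> R) (G : probability (borel Omega) R) :
    bounded_continuous h -> \int[G]_t (c + h t) = c + \int[G]_t h t.
  move=> hbc; rewrite RintegralD//.
  - by rewrite Rintegral_cst// [X in _ * fine X]probability_setT mulr1.
  - by apply: (@bounded_integrable _ _ _ G _ `|c|).
  - exact: (@continuous_integrable G).
have up (h : Omega -> R) : continuous h -> (forall t, `|h t| <= M) ->
    \int[mu]_t h t <= lim ((fun G :
      weak_probability Omega => \int[G]_t h t) @ F).
  move=> ch hM.
  have hbc : bounded_continuous h.
    split => //; exists M; split; first exact: num_real.
    by move=> x Mx t _; exact: le_trans (hM t) (ltW Mx).
  have cMh : continuous (fun t => M + h t).
    by move=> t; apply: cvgD; [exact: cvg_cst|exact: ch].
  have := @le_limit_integral (fun t => M + h t) (M + M) cMh.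
  have -> : (fun G : weak_probability Omega => \int[G]_t (M + h t)) =
            (fun G : weak_probability Omega => M + \int[G]_t h t).
    by apply/funext => G; exact: shift.
  rewrite shift// limD; [|exact: is_cvg_cst|exact: cvg_g hM].
  rewrite lim_cst// lerD2l; apply => t.
  by have := hM t; rewrite ler_norml; lra.
have /cvg_ex[a ca] := cvg_g g M cg gM.
suff -> : \int[mu]_t g t = a by [].
apply/eqP; rewrite eq_le; apply/andP; split.
  by rewrite -(cvg_lim _ ca)//; exact: up.
rewrite -lerN2.
have opp (G : probability (borel Omega) R) :
  \int[G]_t (- g t) = - \int[G]_t g t.
  rewrite -mulN1r -RintegralZl//; last exact: continuous_integrable.
  by apply: eq_Rintegral => t _; rewrite mulN1r.
rewrite -opp; have ->
  : - a = lim ((fun G : weak_probability Omega => \int[G]_t (- g t)) @ F).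
  apply/esym/cvg_lim => //.
  under eq_fun do rewrite opp.
  exact: cvgN.
apply: up => [t|t]; last by rewrite normrN.
by apply: cvgN; exact: cg.
Qed.

End compactness.

Section weak_topology.
Context {R : realType} (Omega : pmetricType R).

Let evaluation_topology (g : {g : Omega -> R | bounded_continuous g}) :=
  Topological.class (initial_topology
    (fun G : weak_probability Omega => \int[G]_t (sval g t))).

Lemma initial_cvg (X : choiceType) (Z : topologicalType) (f : X -> Z)
    (F : set_system X) (x : X) : Filter F ->
  F --> (x : initial_topology f) <-> f @ F --> f x.
Proof.
move=> FF; split=> [Fx|Ffx A].
  exact: (@continuous_cvg _ (initial_topology f)) (@initial_continuous _ _ f
    x) Fx.
rewrite nbhsE => -[B [[C oC <-] Cx] BA]; apply: filterS BA _.
by apply: Ffx; exact: open_nbhs_nbhs.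
Qed.

(** Convergence for a supremum of topologies is convergence for each of them, here one for each test
    function. *)
Lemma weak_cvgP (F : set_system (weak_probability Omega)) (FF : Filter F)
    (G : weak_probability Omega) :
  F --> G <-> (forall g : Omega -> R, bounded_continuous g ->
    (fun H : weak_probability Omega => \int[H]_t g t) @ F --> \int[G]_t g t).
Proof.
split=> [|FG].
  move=> /(@cvg_sup _ _ evaluation_topology F G FF) FG g gbc.
  by have /initial_cvg := FG (exist _ g gbc).
apply/(@cvg_sup _ _ evaluation_topology F G FF) => -[g gbc].
by apply/initial_cvg; exact: FG.
Qed.

Lemma weak_integral_continuous (g : Omega -> R) : bounded_continuous g ->
  continuous (fun G : weak_probability Omega => \int[G]_t g t).
Proof. by move=> gbc G; have /weak_cvgP := @cvg_id _ (nbhs G); apply. Qed.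

(** Every ultrafilter converges, namely to its [limit_measure]. *)
Lemma weak_probability_compact : compact [set: Omega] ->
  compact [set: weak_probability Omega].
Proof.
move=> cptOmega; rewrite compact_ultra => F UF _.
exists (limit_measure UF cptOmega : probability (borel Omega) R); split => //.
by apply/weak_cvgP => g gbc; exact: limit_integral.
Qed.
End weak_topology.

(** * Finite partitions and discrete probabilities *)

(** One point is picked in each member of a countable base. Countability later allows exceptional
    null sets to be united. *)
Lemma compact_dense_sequence (R : realType) (T : pmetricType R) :
  compact [set: T] -> exists D : nat -> T,
    forall O : set T, open O -> O !=set0 -> exists n, O (D n).
Proof.
move=> /compact_second_countable[B /countable_injP[i i_inj] [Bo Bb]].
(* An index that encodes no nonempty base set yields the default [point]. *)
exists (fun n => xget point [set x | exists2 U, B U /\ i U = n & U x]).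
move=> O oO [x Ox]; have [U [BU Ux] UO] := Bb x O (open_nbhs_nbhs (conj oO Ox)).
exists (i U); case: xgetP => [y _ [V [BV iVU] Vy]|/(_ x)[]]; last by exists U.
by apply: UO => /=; rewrite -(i_inj V U (mem_set BV) (mem_set BU) iVU).
Qed.

Lemma compact_unif_continuous (R : realType) (T : pmetricType R) (h : T -> R)
    (e : R) : compact [set: T] -> continuous h -> 0 < e ->
  \forall k \near \oo, forall t t', ball t k.+1%:R^-1 t' -> `|h t - h t'| < e.
Proof.
move=> cT ch e0.
suff : \forall k \near \oo, forall t, setT t ->
    forall t', ball t k.+1%:R^-1 t' -> `|h t - h t'| < e.
  by apply: filterS => k kt t t'; exact: kt.
move/compact_near_coveringP: cT; apply => x _.
have e20 : 0 < e / 2 by rewrite divr_gt0.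
have /nbhs_ballP[d /= d0 xd] : nbhs x [set t | `|h x - h t| < e / 2].
  by have /cvgrPdist_lt := ch x; exact.
have d20 : 0 < d / 2 by rewrite divr_gt0.
exists (ball x (d / 2), [set k | k.+1%:R^-1 < d / 2]).
  by split; [exact: nbhsx_ballx|exact: (near_infty_natSinv_lt (PosNum d20))].
case=> t k /= [xt kd] t' tt'.
have xt1 : `|h x - h t| < e / 2.
  by apply: xd; apply: le_ball xt; rewrite ler_pdivrMr// ler_peMr ?ler1n// ltW.
have xt2 : `|h x - h t'| < e / 2.
  by apply: xd; apply: ball_split xt _; apply: le_ball tt'; exact: ltW.
rewrite [ltRHS]splitr (le_lt_trans _ (ltrD xt1 xt2))//.
by rewrite (distrC (h x)) (le_trans _ (ler_normD _ _))// addrA subrK.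
Qed.

(** A finite subcover is made disjoint by sending [t] to the first member that contains it. Each
    cell is an open set minus finitely many earlier ones, hence Borel. *)
Lemma finite_step (R : realType) (T : pmetricType R) (O : T -> set T) :
  compact [set: T] -> (forall t, open (O t)) -> (forall t, O t t) ->
  exists m (s : 'I_m -> T) (c : T -> 'I_m),
    (forall a, measurable (c @^-1` [set a] : set (borel T))) /\
    forall t, O (s (c t)) t.
Proof.
rewrite compact_cover => cT oO Ott.
have [|D _ cov] := cT T setT O (fun t _ => oO t).
  by move=> t _; exists t.
pose s := enum_fset D; pose m := size s.
pose q t i := `[< O (nth point s i) t >].
have qm t : (find (q t) (iota 0 m) < m)%N.
  rewrite -[ltnRHS](size_iota 0 m) -has_find.
  have [u uD Out] := cov t I; apply/hasP; exists (index u s).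
    by rewrite mem_iota/= add0n index_mem.
  by apply/asboolP; rewrite nth_index.
exists m, (fun a => nth point s a), (fun t => Ordinal (qm t)); split;
  last first.
  move=> t /=; have : has (q t) (iota 0 m) by rewrite has_find size_iota.
  by move=> /(nth_find 0%N); rewrite nth_iota// add0n => /asboolP.
move=> a; rewrite (_ : _ @^-1` _ = O (nth point s a) `\`
    \big[setU/set0]_(i < a) O (nth point s i)).
  apply: (@measurableD _ (borel T)); first exact: borel_open.
  by apply: bigsetU_measurable => i _; exact: borel_open.
apply/seteqP; split => t /=.
  move=> /(congr1 val) /= ta; split.
    have : has (q t) (iota 0 m) by rewrite has_find size_iota.
    by move=> /(nth_find 0%N); rewrite nth_iota// add0n ta => /asboolP.
  rewrite -(bigcup_mkord a (fun i => O (nth point s i))) => -[i /= ia Oit].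
  have := @before_find _ 0%N (q t) (iota 0 m) i; rewrite ta => /(_ ia).
  rewrite nth_iota ?(ltn_trans ia)// add0n => /negP; apply; exact/asboolP.
rewrite -(bigcup_mkord a (fun i => O (nth point s i))) => -[Oa nO];
  apply/val_inj => /=.
apply/eqP; rewrite eqn_leq; apply/andP; split; rewrite leqNgt; apply/negP => lt.
  have := @before_find _ 0%N (q t) (iota 0 m) a lt.
  by rewrite nth_iota// add0n => /negP; apply; exact/asboolP.
apply: nO; exists (find (q t) (iota 0 m)) => //=.
have : has (q t) (iota 0 m) by rewrite has_find size_iota.
by move=> /(nth_find 0%N); rewrite nth_iota// add0n => /asboolP.
Qed.

Lemma Rintegral_step (R : realType) d (T : measurableType d)
    (P : {finite_measure set T -> \bar R}) m (c : T -> 'I_m) (phi : 'I_m -> R) :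
  (forall a, measurable (c @^-1` [set a])) ->
  P.-integrable setT (EFin \o (phi \o c)) /\
  \int[P]_t phi (c t) = \sum_(a < m) fine (P (c @^-1` [set a])) * phi a.
Proof.
move=> mc.
have iA (a : 'I_m) : P.-integrable setT
    (EFin \o (fun t => phi a * \1_(c @^-1` [set a]) t)).
  apply: (@bounded_integrable _ _ _ _ _ `|phi a|).
    by apply: measurable_funM => //; exact: measurable_indic.
  by move=> t; rewrite normrM ler_piMr// indicE; case: (_ \in _);
    rewrite ?normr1 ?normr0.
have E t : phi (c t) = \sum_(a < m) phi a * \1_(c @^-1` [set a]) t.
  rewrite (bigD1 (c t))//= big1 => [|a /eqP ac].
    by rewrite indicE mem_set// mulr1 addr0.
  by rewrite indicE memNset ?mulr0// => /esym.
have [i1 i2] := Rintegral_sum (index_enum _) iA; split.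
  by rewrite -[phi \o c]/(fun t => phi (c t)) (funext E).
rewrite (funext E) i2; apply: eq_bigr => a _.
rewrite RintegralZl ?Rintegral_indicator 1?mulrC//.
exact: integrable_indicator.
Qed.

Lemma sum_step_weights (R : realType) d (T : measurableType d)
    (P : probability T R) m (c : T -> 'I_m) :
  (forall a, measurable (c @^-1` [set a])) ->
  \sum_(a < m) fine (P (c @^-1` [set a])) = 1.
Proof.
move=> mc; have [_] := Rintegral_step P (fun _ => 1) mc.
rewrite Rintegral_cst// mul1r [X in fine X]probability_setT/= => ->.
by apply: eq_bigr => a _; rewrite mulr1.
Qed.

Lemma discrete_measure (R : realType) d (T : measurableType d) (I : Type)
    (r : seq I) (w : I -> R) (s : I -> T) : (forall i, 0 <= w i) ->
  exists P : {measure set T -> \bar R},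
    (forall A, P A = \sum_(i <- r) (w i)%:E * \d_(s i) A)%E /\
    (forall h : T -> \bar R, measurable_fun setT h -> (forall t, 0 <= h t)%E ->
      \int[P]_t h t = \sum_(i <- r) (w i)%:E * h (s i))%E.
Proof.
move=> w0; elim: r => [|i r [P [PA Ph]]].
  exists mzero; split=> [A|h mh h0]; first by rewrite big_nil.
  by rewrite big_nil integral_measure_zero.
exists (measure_add (mscale (NngNum (w0 i)) (dirac (s i))) P);
  split=> [A|h mh h0].
  by rewrite big_cons -PA [LHS]measure_addE.
rewrite ge0_integral_measure_add// big_cons Ph//; congr (_ + _)%E.
by rewrite ge0_integral_mscale// integral_dirac// diracT mul1e.
Qed.

Lemma discrete_probability (R : realType) d (T : measurableType d) (I : finType)
    (w : I -> R) (s : I -> T) : (forall i, 0 <= w i) -> \sum_i w i = 1 ->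
  exists P : probability T R,
    (forall A, P A = \sum_i (w i)%:E * \d_(s i) A)%E /\
    (forall (h : T -> R) (M : R), measurable_fun setT h ->
      (forall t, `|h t| <= M) -> \int[P]_t h t = \sum_i w i * h (s i)).
Proof.
move=> w0 w1; have [P [PA Ph]] := discrete_measure (index_enum I) s w0.
have PT : P setT = 1%E.
  rewrite PA (eq_bigr (fun i => (w i)%:E)) ?sumEFin ?w1//.
  by move=> i _; rewrite diracT mule1.
(* Normalization only supplies the structure of a probability: the mass is already 1, so no value
   changes. *)
pose Q : probability T R := mnormalize P (dirac point).
have QP A : Q A = P A.
  by rewrite /Q /= /mnormalize PT onee_eq0/= invr1 mule1.
exists Q; split=> [A|h M mh hM]; first by rewrite QP PA.
have ih : Q.-integrable setT (EFin \o h) by exact: (@bounded_integrable _ _ _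
  Q _ M).
have iM : Q.-integrable setT (EFin \o cst M) by apply: (@bounded_integrable _
  _ _ Q _ `|M|).
(* The formula for [P] covers nonnegative functions only, so [h] is shifted by its bound [M] and the
   shift is cancelled at the end. *)
have : \int[Q]_t (M + h t) = \sum_i w i * (M + h (s i)).
  rewrite /Rintegral (eq_measure_integral P) => [|A _ _]; last exact: QP.
  rewrite Ph.
  - by under eq_bigr do rewrite -EFinM; rewrite sumEFin.
  - by apply/measurable_EFinP; exact: measurable_funD.
  - by move=> t; rewrite lee_fin; have := hM t; rewrite ler_norml; lra.
rewrite RintegralD// Rintegral_cst// [X in _ * fine X]probability_setT mulr1.
under eq_bigr do rewrite mulrDr.
by rewrite big_split/= -mulr_suml w1 mul1r => /addrI.
Qed.

(** Meant for numerators [k] obtained by rounding up [N * w] in [m] cells, with total [S]. Rounding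
    up adds at most [1/N], and dividing by [S] instead of [N] removes at most [w * m/N]. *)
Lemma rounded_weight (R : realType) (N k m S : nat) (w : R) : (0 < N)%N ->
  0 <= w ->
  N%:R * w <= k%:R <= N%:R * w + 1 -> (N <= S)%N -> (S <= N + m)%N ->
  `|w - k%:R / S%:R| <= N%:R^-1 + w * (m%:R / N%:R).
Proof.
move=> N0 w0 /andP[k1 k2] NS SN.
have N0' : (0 : R) < N%:R by rewrite ltr0n.
have S0' : (0 : R) < S%:R by rewrite ltr0n (leq_trans N0).
have SN' : (S%:R : R) <= N%:R + m%:R by rewrite -natrD ler_nat.
have NS' : (N%:R : R) <= S%:R by rewrite ler_nat.
have Nx : N%:R * N%:R^-1 = 1 :> R by rewrite mulfV// gt_eqF.
have Sy : S%:R * S%:R^-1 = 1 :> R by rewrite mulfV// gt_eqF.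
have y0 : (0 : R) <= S%:R^-1 by rewrite invr_ge0 ltW.
have yx : S%:R^-1 <= N%:R^-1 :> R by rewrite lef_pV2.
have h1 : k%:R / S%:R <= w + N%:R^-1.
  rewrite (le_trans (ler_wpM2r y0 k2))//.
  have -> : w + N%:R^-1 = (N%:R * w + 1) / N%:R by rewrite mulrDl mulrAC Nx
    !mul1r.
  by rewrite ler_wpM2l// addr_ge0// mulr_ge0// ltW.
have h2 : w <= k%:R / S%:R + w * (m%:R / N%:R).
  have wE : w = w * S%:R / S%:R by rewrite -mulrA Sy mulr1.
  rewrite [leLHS]wE.
  have : w * S%:R / S%:R <= w * (N%:R + m%:R) / S%:R.
    by rewrite ler_wpM2r// ler_wpM2l.
  move=> /le_trans; apply; rewrite mulrDr mulrDl lerD//.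
    by rewrite ler_wpM2r// mulrC.
  by rewrite -mulrA ler_wpM2l// ler_wpM2l.
have w1 : 0 <= w * (m%:R / N%:R) by rewrite mulr_ge0// divr_ge0.
have : 0 < N%:R^-1 :> R by rewrite invr_gt0.
by rewrite ler_norml; lra.
Qed.

Lemma geometric_nneseries_lty (R : realType) (u : nat -> \bar R) (C Q : R) :
  0 <= Q < 1 -> 0 <= C -> (forall k, (0 <= u k)%E) ->
  (forall k, (u k <= (C * Q ^+ k)%:E)%E) -> (\sum_(k <oo) u k < +oo)%E.
Proof.
move=> /andP[Q0 Q1] C0 u0 uC.
apply: (@le_lt_trans _ _ (C / (1 - Q))%:E); last exact: ltry.
apply: lime_le; first exact: is_cvg_nneseries.
apply: nearW => k; rewrite big_mkord.
apply: (@le_trans _ _ (\sum_(i < k) (C * Q ^+ i)%:E)%E); first exact: lee_sum.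
rewrite sumEFin lee_fin -mulr_sumr ler_wpM2l// -[leRHS]mul1r ler_pdivlMr
  ?subr_gt0//.
have -> : (\sum_(i < k) Q ^+ i) * (1 - Q) = 1 - Q ^+ k.
  by rewrite -(opprB (Q ^+ k)) subrX1 -mulNr opprB mulrC.
by rewrite gerBl exprn_ge0.
Qed.

Lemma ae_forall_ord (R : realType) (m : measure_display)
    (U : measurableType m) (nu : {measure set U -> \bar R}) n (Q : 'I_n ->
      U -> Prop) :
  (forall i, {ae nu, forall w, Q i w}) -> {ae nu, forall w, forall i, Q i w}.
Proof.
move=> QP; have : {ae nu, forall w, forall k (kn : (k < n)%N),
  Q (Ordinal kn) w}.
  apply: ae_foralln => k; have [kn|kn] := pselect (is_true (k < n)%N);
    last first.
    by apply: aeW => w kn'; case: (kn kn').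
  by apply: filterS (QP (Ordinal kn)) => w Qw kn';
    rewrite (bool_irrelevance kn' kn).
by apply: filterS => w Qw [k kn].
Qed.

(** * Independence and densities *)

Section weighted_transfer.
Import HBNNSimple.
Local Open Scope ereal_scope.
Context (R : realType) d (T : measurableType d) (phi : T -> R).
Hypothesis mphi : measurable_fun setT phi.
Hypothesis phi_ge0 : forall y, (0 <= phi y)%R.

Let mEphi : measurable_fun setT (EFin \o phi). Proof. exact/measurable_EFinP.
  Qed.

Let approx n : {nnsfun T >-> R} := nnsfun_approx measurableT mEphi n.

(** Monotone convergence along simple approximations of [phi]. The right-hand side depends on [m],
    [W] and [Z] only through the integrals of [W] against indicators of [Z]. *)
Lemma weighted_integral_lim d' (X : measurableType d')
    (m : {measure set X -> \bar R}) (W : X -> R) (Z : X -> T) :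
  measurable_fun setT W -> (forall x, (0 <= W x)%R) -> measurable_fun setT Z ->
  \int[m]_x (W x * phi (Z x))%:E = limn (fun n => \sum_(r \in range (approx n))
    r%:E * \int[m]_x (W x * \1_(approx n @^-1` [set r]) (Z x))%:E).
Proof.
move=> mW W0 mZ.
have mA n : measurable_fun setT (approx n) by exact: measurable_funP.
transitivity (limn (fun n => \int[m]_x (W x * approx n (Z x))%:E)).
  rewrite -monotone_convergence//.
  - apply: eq_integral => x _; apply/esym/cvg_lim => //.
    under eq_fun do rewrite EFinM.
    rewrite EFinM; apply: cvgeZl => //.
    by apply: (@cvg_nnsfun_approx _ _ _ _ measurableT _ mEphi) => // y _;
      rewrite lee_fin.
  - move=> n; apply/measurable_EFinP; apply: measurable_funM => //.
    exact: measurableT_comp.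
  - by move=> n x _; rewrite lee_fin mulr_ge0.
  - move=> x _ a b ab; rewrite lee_fin ler_wpM2l//.
    exact/lefP/nd_nnsfun_approx.
congr (limn _); apply/funext => n.
have mI r : measurable_fun setT (fun x => W x * \1_(approx n @^-1` [set r]) (Z
  x))%R.
  have mi : measurable_fun setT (\1_(approx n @^-1` [set r]) : T -> R).
    by apply: measurable_indic; rewrite -[X in measurable X]setTI; exact: mA.
  by apply: measurable_funM => //; exact: (measurableT_comp mi mZ).
transitivity (\sum_(r \in range (approx n))
    \int[m]_x (r * (W x * \1_(approx n @^-1` [set r]) (Z x)))%:E).
  rewrite -ge0_integral_fsum//; last 2 first.
  - by move=> r; apply/measurable_EFinP; exact: measurable_funM.
  - move=> r x _; rewrite lee_fin indicE;
    have [/set_mem<-|] := boolP (Z x \in _).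
      by rewrite !mulr_ge0.
    by rewrite !mulr0.
  apply: eq_integral => x _; rewrite fsumEFin// (fimfunE (approx n) (Z x)).
  congr EFin; rewrite !fsbig_finite//= mulr_sumr.
  by apply: eq_bigr => r _; rewrite mulrCA.
apply: eq_fsbigr => r /set_mem[y _ <-].
under eq_integral do rewrite EFinM.
rewrite ge0_integralZl//.
- exact/measurable_EFinP.
- by move=> x _; rewrite lee_fin mulr_ge0.
- by rewrite lee_fin.
Qed.

(** An identity tested on indicators extends to every nonnegative measurable function. With a
    constant weight this factors out an independent variable; with a density as weight it changes
    variables. *)
Lemma weighted_transfer d1 d2 (X1 : measurableType d1) (X2 : measurableType d2)
    (m1 : {measure set X1 -> \bar R}) (m2 : {measure set X2 -> \bar R})
    (W1 : X1 -> R) (W2 : X2 -> R) (Z1 : X1 -> T) (Z2 : X2 -> T) :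
  measurable_fun setT W1 -> (forall x, (0 <= W1 x)%R) ->
    measurable_fun setT Z1 ->
  measurable_fun setT W2 -> (forall x, (0 <= W2 x)%R) ->
    measurable_fun setT Z2 ->
  (forall A, measurable A ->
    \int[m1]_x (W1 x * \1_A (Z1 x))%:E = \int[m2]_x (W2 x * \1_A (Z2 x))%:E) ->
  \int[m1]_x (W1 x * phi (Z1 x))%:E = \int[m2]_x (W2 x * phi (Z2 x))%:E.
Proof.
move=> mW1 W10 mZ1 mW2 W20 mZ2 E; rewrite !weighted_integral_lim//.
congr (limn _); apply/funext => n; apply: eq_fsbigr => r _; rewrite E//.
Qed.

End weighted_transfer.

Section independence.
Context (R : realType) dS (S : measurableType dS) (P : probability S R)
  d (T : measurableType d) (I : finType) (X : I -> {RV P >-> T}).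
Local Open Scope ereal_scope.

(* The non-indicator factors are the ones indexed by r, and are introduced one
   at a time. *)
Let independent_prod_seq (r : seq I) : mutually_independent X ->
  forall phi : I -> T -> R,
  (forall i, measurable_fun setT (phi i)) -> (forall i y, (0 <= phi i y)%R) ->
  (forall i, \int[P]_w (phi i (X i w))%:E < +oo) ->
  (forall i, i \notin r -> exists2 A, measurable A & phi i = \1_A) ->
  \int[P]_w (\prod_i phi i (X i w))%:E = \prod_i \int[P]_w (phi i (X i w))%:E.
Proof.
move=> indep; elim: r => [|k r IH] phi mphi phi0 phi_fin phi_ind.
  have /choice[A A_] : forall i, exists A, measurable A /\ phi i = \1_A.
    by move=> i; have [//|A mA pA] := phi_ind i; exists A.
  have mA i : measurable (A i) by have [] := A_ i.
  have mXA i : measurable (X i @^-1` A i).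
    by rewrite -[Y in measurable Y]setTI; exact: measurable_funP.
  have -> : (fun w => (\prod_i phi i (X i w))%:E) =
      (fun w => (\1_(\bigcap_(i in [set` [set: I]%SET]) X i @^-1` A i) w)%:E).
    apply/funext => w; congr EFin; rewrite indicE.
    have [/set_mem wA|/negP wA] := boolP (w \in _).
      apply: big1 => i _; have [_ ->] := A_ i; rewrite indicE mem_set//.
      by apply: wA => /=; rewrite finset.inE.
    have [i wi] : exists i, ~ A i (X i w).
      apply/existsNP => wA'; apply: wA; apply/mem_set => i _; exact: wA'.
    rewrite (bigD1 i)//=; have [_ ->] := A_ i.
    by rewrite indicE memNset ?mul0r.
  rewrite integral_indic//; last first.
    by apply: fin_bigcap_measurable => // i _; exact: mXA.
  rewrite setIT.
  transitivity (\prod_(i in [set: I]%SET) P (X i @^-1` A i)).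
    exact: (indep [set: I]%SET A mA).
  apply: eq_big => [i|i _]; first by rewrite finset.inE.
  have [_ ->] := A_ i; rewrite -[RHS](_ :
    \int[P]_w (\1_(X i @^-1` A i) w)%:E = _).
    by rewrite integral_indic// setIT.
  by apply: eq_integral => w _; rewrite !indicE.
pose C := \prod_(i | i != k) \int[P]_w (phi i (X i w))%:E.
have E0 i : 0 <= \int[P]_w (phi i (X i w))%:E by apply: integral_ge0 => w _;
  rewrite lee_fin.
(* The factors are finite by assumption, so that [fine C] can serve as a real weight. *)
have Cfin : C \is a fin_num.
  rewrite /C; elim/big_ind : _ => // [x y xf yf|i _]; first by rewrite fin_numM.
  by rewrite ge0_fin_numE.
have C0 : (0 <= fine C)%R by rewrite fine_ge0// /C; apply: prode_ge0.
pose W w := (\prod_(i | i != k) phi i (X i w))%R.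
have mX i : measurable_fun setT (X i) by exact: measurable_funP.
have mW : measurable_fun setT W.
  rewrite /W (_ : (fun w => _) = (fun w =>
      \prod_(i <- [seq i <- index_enum I | i != k]) phi i (X i w))%R).
    by apply: measurable_prod => i _; exact: (measurableT_comp (mphi i) (mX i)).
  by apply/funext => w; rewrite big_filter.
have W0 w : (0 <= W w)%R by exact: prodr_ge0.
transitivity (\int[P]_w (W w * phi k (X k w))%:E).
  by apply: eq_integral => w _; rewrite (bigD1 k)//= mulrC.
(* By transfer, replacing the other factors by the constant [fine C] has to be justified only when
   the factor at [k] is an indicator. *)
rewrite (@weighted_transfer _ _ _ (phi k) (mphi k) (phi0 k) _ _ _ _ P P W (cst
  (fine C)) (X k) (X k))//; last first.
  move=> A mA.
  (* With an indicator at [k], every factor outside [r] is an indicator and the induction hypothesis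
     applies. *)
  pose phi' i := if i == k then \1_A : T -> R else phi i.
  have phi'N i : i != k -> phi' i = phi i by rewrite /phi' => /negbTE ->.
  have phi'k : phi' k = \1_A by rewrite /phi' eqxx.
  have m1 : measurable_fun setT (\1_A : T -> R) by exact: measurable_indic.
  have m1X : measurable_fun setT (fun w => \1_A (X k w) : R).
    exact: (measurableT_comp m1 (mX k)).
  have : \int[P]_w (\prod_i phi' i (X i w))%:E = \prod_i \int[P]_w (phi' i (X
    i w))%:E.
    apply: IH.
    - by move=> i; rewrite /phi'; case: ifP.
    - by move=> i y; rewrite /phi'; case: ifP.
    - move=> i; have [->|ik] := eqVneq i k; last by rewrite phi'N.
      rewrite phi'k (@le_lt_trans _ _ 1)// ?ltry//.
      rewrite -(probability_setT P) -[leRHS]mul1e -integral_cst//.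
      apply: ge0_le_integral => //.
      + exact/measurable_EFinP.
      + by move=> w _; rewrite lee_fin indicE lern1 leq_b1.
    - move=> i ir; have [->|ik] := eqVneq i k; first by exists A.
      by rewrite phi'N//; apply: phi_ind; rewrite inE negb_or ik.
  rewrite [X in _ = X -> _](bigD1 k)//= phi'k.
  rewrite [X in _ = _ * X ->
    _](eq_bigr (fun i => \int[P]_w (phi i (X i w))%:E));
      last by move=> i /phi'N ->.
  under eq_integral.
    move=> w _; rewrite (bigD1 k)//= phi'k.
    rewrite (eq_bigr (fun i => phi i (X i w))); last by move=> i /phi'N ->.
    rewrite mulrC; over.
  move=> ->.
  under [RHS]eq_integral do rewrite EFinM.
  rewrite [RHS]ge0_integralZl ?lee_fin//; last exact/measurable_EFinP.
  by rewrite fineK// muleC.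
under eq_integral do rewrite /= EFinM.
rewrite ge0_integralZl ?lee_fin//; last 2 first.
- by apply/measurable_EFinP; exact: (measurableT_comp (mphi k) (mX k)).
- by move=> w _; rewrite lee_fin.
by rewrite fineK// [RHS](bigD1 k)//= muleC.
Qed.

Lemma independent_prod : mutually_independent X -> forall phi : I -> T -> R,
  (forall i, measurable_fun setT (phi i)) -> (forall i y, (0 <= phi i y)%R) ->
  (forall i, \int[P]_w (phi i (X i w))%:E < +oo) ->
  \int[P]_w (\prod_i phi i (X i w))%:E = \prod_i \int[P]_w (phi i (X i w))%:E.
Proof.
move=> indep phi mphi phi0 phi_fin.
apply: (independent_prod_seq (r := enum I)) => // i.
by rewrite mem_enum.
Qed.

Lemma integral_density (mu : {measure set T -> \bar R}) (p : T -> R)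
    (Z : {RV P >-> T}) (phi : T -> R) :
  measurable_fun setT p -> (forall y, (0 <= p y)%R) ->
  (forall A, measurable A -> distribution P Z A = \int[mu]_(y in A) (p y)%:E) ->
  measurable_fun setT phi -> (forall y, (0 <= phi y)%R) ->
  \int[P]_w (phi (Z w))%:E = \int[mu]_y (p y * phi y)%:E.
Proof.
move=> mp p0 pZ mphi phi0.
transitivity (\int[P]_w (cst 1 w * phi (Z w))%:E).
  by apply: eq_integral => w _; rewrite mul1r.
apply: (@weighted_transfer _ _ _ phi mphi phi0 _ _ _ _ P mu (cst 1%R) p Z id)
  => //.
move=> A mA.
transitivity (distribution P Z A).
  rewrite -[distribution P Z A]/(P (Z @^-1` A)) -[X in P X]setIT
    -integral_indic//; last first.
    by rewrite -[X in measurable X]setTI; exact: measurable_funP.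
  by apply: eq_integral => w _; rewrite mul1r !indicE.
rewrite pZ// integral_mkcond; apply: eq_integral => y _.
by rewrite /patch indicE; case: ifP => yA; rewrite ?mulr1 ?mulr0.
Qed.

End independence.

(** * Affinity and likelihood ratios *)

Section affinity.
Context (R : realType) (d : measure_display) (T : measurableType d)
  (mu : {measure set T -> \bar R}).

(** The Hellinger affinity, or Bhattacharyya coefficient, when [a] and [b] are densities. *)
Definition affinity (a b : T -> R) : \bar R :=
  (\int[mu]_y (Num.sqrt (a y * b y))%:E)%E.

Lemma measurable_sqrt (a : T -> R) : measurable_fun setT a ->
  measurable_fun setT (fun y => Num.sqrt (a y)).
Proof.
move=> ma; have ms : measurable_fun setT (@Num.sqrt R).
  by apply: continuous_measurable_fun => x; exact: sqrt_continuous.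
exact: (measurableT_comp ms ma).
Qed.

Lemma measurable_sqrt_mul (a b : T -> R) : measurable_fun setT a ->
  measurable_fun setT b -> measurable_fun setT (fun y => Num.sqrt (a y * b y)).
Proof.
by move=> ma mb; apply: measurable_sqrt; exact: measurable_funM.
Qed.

(** Integrating [sqrt (a b) + (sqrt a - sqrt b)^2 / 2 = (a + b) / 2] shows that the affinity and the
    integral of the square term sum to 1. The latter vanishes only if [a = b] almost everywhere. *)
Lemma affinity_lt1 (a b : T -> R) :
  measurable_fun setT a -> measurable_fun setT b ->
  (forall y, 0 <= a y) -> (forall y, 0 <= b y) ->
  (\int[mu]_y (a y)%:E = 1)%E -> (\int[mu]_y (b y)%:E = 1)%E ->
  ~ {ae mu, forall y, a y = b y} -> (affinity a b < 1)%E.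
Proof.
move=> ma mb a0 b0 a1 b1 nab.
pose r y := Num.sqrt (a y * b y).
pose v y := (Num.sqrt (a y) - Num.sqrt (b y)) ^+ 2 / 2.
have mr : measurable_fun setT r by exact: measurable_sqrt_mul.
have mv : measurable_fun setT v.
  apply: measurable_funM => //; apply: measurable_funX.
  by apply: measurable_funB; exact: measurable_sqrt.
have r0 y : 0 <= r y by exact: sqrtr_ge0.
have v0 y : 0 <= v y by rewrite divr_ge0// sqr_ge0.
have rv y : r y + v y = (a y + b y) / 2.
  rewrite /r /v sqrtrM// sqrrB !sqr_sqrtr//; lra.
have : (\int[mu]_y (r y)%:E + \int[mu]_y (v y)%:E = 1)%E.
  rewrite -ge0_integralD//; [|by move=> y _;
    rewrite lee_fin|exact/measurable_EFinP
    |by move=> y _; rewrite lee_fin|exact/measurable_EFinP].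
  under eq_integral do rewrite -EFinD rv EFinM EFinD.
  rewrite ge0_integralZr//; last 2 first.
  - by apply: emeasurable_funD; exact/measurable_EFinP.
  - by move=> y _; rewrite -EFinD lee_fin addr_ge0.
  rewrite ge0_integralD//; [|by move=> y _;
    rewrite lee_fin|exact/measurable_EFinP
    |by move=> y _; rewrite lee_fin|exact/measurable_EFinP].
  by rewrite a1 b1 -EFinD -EFinM; congr EFin; lra.
have iv0 : (0 <= \int[mu]_y (v y)%:E)%E by apply: integral_ge0 => y _;
  rewrite lee_fin.
have ir0 : (0 <= \int[mu]_y (r y)%:E)%E by apply: integral_ge0 => y _;
  rewrite lee_fin.
have vN0 : (\int[mu]_y (v y)%:E != 0)%E.
  apply/eqP => v00; apply: nab.
  have v_ae0 : ae_eq mu setT (EFin \o v) (cst 0%E).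
    apply/ae_eq_integral_abs => //; first exact/measurable_EFinP.
    by rewrite -[RHS]v00; apply: eq_integral => y _; rewrite gee0_abs ?lee_fin.
  apply: filterS v_ae0 => y /(_ I) [] /eqP.
  rewrite mulf_eq0 invr_eq0 pnatr_eq0 orbF sqrf_eq0 subr_eq0.
  by rewrite eqr_sqrt// => /eqP.
move: ir0 iv0 vN0; rewrite /affinity -/r.
case: (\int[mu]_y (r y)%:E)%E => [x| |]//;
  case: (\int[mu]_y (v y)%:E)%E => [z| |]// x0 z0 zN0.
rewrite -EFinD => -[xz]; rewrite lte_fin -xz ltrDl lt_neqAle eq_sym.
by rewrite -lee_fin z0 andbT -eqe.
Qed.

End affinity.

(** * Exponential tail bound for likelihood ratios *)

Section likelihood.
Context (R : realType) dS (S : measurableType dS) (P : probability S R)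
  d (T : measurableType d) (mu : {measure set T -> \bar R}) (n : nat)
  (X : 'I_n.+1 -> {RV P >-> T}) (p : 'I_n.+1 -> T -> R).
Hypothesis X_indep : mutually_independent X.
Hypothesis mp : forall i, measurable_fun setT (p i).
Hypothesis p_ge0 : forall i y, 0 <= p i y.
Hypothesis X_dens : forall i A, measurable A ->
  distribution P (X i) A = (\int[mu]_(y in A) (p i y)%:E)%E.
Context (a b : T -> R) (c q : R).
Hypothesis aE : forall y, a y = \sum_i n.+1%:R^-1 * p i y.
Hypothesis mb : measurable_fun setT b.
Hypothesis c_ge0 : 0 <= c.
Hypothesis ab_affinity : (affinity mu b a <= q%:E)%E.

Let ratio y := Num.sqrt (c * b y / a y).

Let ma : measurable_fun setT a.
Proof.
rewrite (_ : a = fun y => \sum_i n.+1%:R^-1 * p i y); last exact/funext.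
by apply: measurable_sum => i; exact: measurable_funM.
Qed.

Let a_ge0 y : 0 <= a y.
Proof. by rewrite aE; apply: sumr_ge0 => i _; rewrite mulr_ge0. Qed.

Let mratio : measurable_fun setT ratio.
Proof.
apply: measurable_sqrt; apply: measurable_funM; first exact: measurable_funM.
(* The inverse and the power -1 agree on nonnegative reals, at 0 as well, where both are 0. *)
rewrite (_ : (fun y => (a y)^-1) = (fun y => a y `^ (-1))).
  exact: (measurableT_comp (measurable_powR (-1)) ma).
by apply/funext => y; rewrite powR_inv1.
Qed.

Let mratioX i : measurable_fun setT (fun w => ratio (X i w)).
Proof. exact: (measurableT_comp mratio (@measurable_funP _ _ _ _ _ (X i))). Qed.

Let mratio_prod : measurable_fun setT (fun w => \prod_i ratio (X i w)).
Proof. by apply: measurable_prod => i _; exact: mratioX. Qed.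

Lemma measurable_likelihood_ratio :
  measurable [set w | 1 <= \prod_i Num.sqrt (c * b (X i w) / a (X i w))].
Proof.
rewrite (_ : [set w | _] = (fun w => \prod_i ratio (X i w)) @^-1` `[1, +oo[).
  by rewrite -[Z in measurable Z]setTI; exact: mratio_prod.
by apply/seteqP; split => w /=; rewrite in_itv/= andbT.
Qed.

(* Markov's inequality for the product of the square roots of the ratios; the
   expectation factorizes, and AM-GM replaces the densities by their mean. *)
Lemma likelihood_tail :
  (P [set w | (1 <= \prod_i Num.sqrt (c * b (X i w) / a (X i w)))%R] <=
   ((Num.sqrt c * q) ^+ n.+1)%:E)%E.
Proof.
have r0 y : 0 <= ratio y by exact: sqrtr_ge0.
pose E i := (\int[P]_w (ratio (X i w))%:E)%E.
have E0 i : (0 <= E i)%E by apply: integral_ge0 => w _; rewrite lee_fin.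
have EE i : E i = (\int[mu]_y (p i y * ratio y)%:E)%E.
  exact: (integral_density (mp i) (p_ge0 i) (X_dens i) mratio r0).
(* Summing over [i] turns the densities into [n.+1 * a]. Where [a] is positive,
   [a * sqrt (c * b / a)] equals [sqrt c * sqrt (b * a)]; where [a] vanishes, the left side is 0. *)
have sumE : (\sum_i E i <= (n.+1%:R * (Num.sqrt c * q))%:E)%E.
  rewrite (eq_bigr _ (fun i _ => EE i)) -ge0_integral_sum//; last 2 first.
  - by move=> i; apply/measurable_EFinP; exact: (measurable_funM (mp i) mratio).
  - by move=> i y _; rewrite lee_fin mulr_ge0.
  apply: (@le_trans _ _ (\int[mu]_y ((n.+1%:R * Num.sqrt c)%:E * (Num.sqrt (b
    y * a y))%:E))%E).
    apply: ge0_le_integral => //.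
    - by move=> y _; apply: sume_ge0 => i _; rewrite lee_fin mulr_ge0.
    - by apply: emeasurable_sum => i; apply/measurable_EFinP;
      exact: (measurable_funM (mp i) mratio).
    - apply/measurable_EFinP; apply: measurable_funM => //.
      exact: measurable_sqrt_mul.
    move=> y _; rewrite sumEFin -EFinM lee_fin -mulr_suml.
    have -> : \sum_i p i y = n.+1%:R * a y.
      by rewrite aE mulr_sumr; apply: eq_bigr => i _; rewrite mulVKf.
    rewrite -!mulrA ler_wpM2l// -sqrtrM//.
    rewrite /ratio; have [->|aN0] := eqVneq (a y) 0.
      by rewrite mul0r sqrtr_ge0.
    rewrite -{1}(ger0_norm (a_ge0 y)) -sqrtr_sqr -sqrtrM ?sqr_ge0//
      ler_wsqrtr//.
    rewrite le_eqVlt; apply/orP; left; apply/eqP; by field.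
  rewrite ge0_integralZl ?lee_fin ?mulr_ge0//; last first.
    by apply/measurable_EFinP; exact: (measurable_sqrt_mul mb ma).
  by rewrite [X in (_ <= X%:E)%E]mulrA [leRHS]EFinM lee_wpmul2l// lee_fin
    mulr_ge0// sqrtr_ge0.
have Efin i : (E i < +oo)%E.
  rewrite (@le_lt_trans _ _ (\sum_i E i)%E)//.
    by rewrite (bigD1 i)//= leeDl// sume_ge0.
  by rewrite (le_lt_trans sumE)// ltry.
have EfinE i : E i = (fine (E i))%:E by rewrite fineK// ge0_fin_numE.
apply: (@le_trans _ _ (\int[P]_w (\prod_i ratio (X i w))%:E)%E).
  rewrite -[X in (P X <= _)%E]setIT -integral_indic//;
    last exact: measurable_likelihood_ratio.
  apply: ge0_le_integral => //.
  - by apply/measurable_EFinP; apply: measurable_indic;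
    exact: measurable_likelihood_ratio.
  - exact/measurable_EFinP.
  move=> w _; rewrite lee_fin indicE; have [/set_mem//|_] := boolP (w \in _).
  by rewrite prodr_ge0.
rewrite (independent_prod X_indep (phi := fun _ => ratio) (fun _ => mratio)
  (fun _ => r0) Efin).
rewrite (eq_bigr _ (fun i _ => EfinE i)) prodEFin lee_fin.
have [AGM _] := @leif_AGM R _ 'I_n.+1 (fun i => fine (E i)) (fun i _ =>
  fine_ge0 (E0 i)).
rewrite card_ord in AGM; apply: le_trans AGM _.
have mean_le : (\sum_i fine (E i)) / n.+1%:R <= Num.sqrt c * q.
  rewrite ler_pdivrMr ?ltr0n// mulrC -lee_fin -sumEFin.
  by rewrite -(eq_bigr _ (fun i _ => EfinE i)).
have mean_ge0 : 0 <= (\sum_i fine (E i)) / n.+1%:R.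
  by rewrite divr_ge0// sumr_ge0// => i _; exact: fine_ge0.
by rewrite lerXn2r ?nnegrE// (le_trans mean_ge0 mean_le).
Qed.

End likelihood.

(** * Mixtures and maximum likelihood *)

Section mixtures.
Context (R : realType) (Omega : pmetricType R) (d : measure_display)
  (T : measurableType d) (mu : {measure set T -> \bar R}) (f : Omega -> T -> R).
Hypothesis f_dens : density_family mu f.
Hypothesis cptOmega : compact [set: Omega].
Context (K : R) (f_le : forall t y, `|f t y| <= K).
Hypothesis f_cont : forall y, continuous (f ^~ y).
Implicit Types G : probability (borel Omega) R.

Let mf t : measurable_fun setT (f t). Proof. by case: (f_dens t). Qed.
Let f_ge0 t y : 0 <= f t y. Proof. by case: (f_dens t). Qed.

Lemma density_bounded_continuous y : bounded_continuous (f ^~ y).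
Proof.
split; last exact: f_cont.
exists K; split; first exact: num_real.
by move=> x Kx t _; exact: le_trans (f_le t y) (ltW Kx).
Qed.

Lemma density_integrable G y : G.-integrable setT (EFin \o f ^~ y).
Proof. exact/(@continuous_integrable _ _ G)/density_bounded_continuous. Qed.

Lemma mixture_ge0 G y : 0 <= mixture f G y.
Proof. by apply: Rintegral_ge0 => t _; exact: f_ge0. Qed.

Lemma mixture_le G y : mixture f G y <= K.
Proof.
rewrite (le_trans (ler_norm _))//; apply: integral_bound => //.
by apply: borel_continuous_measurable; exact: f_cont.
Qed.

(** For each [y] the mixture is a limit of finite sums over cells of radius [1/(k+1)], by uniform
    continuity of the density in the parameter; each sum is measurable in [y]. *)
Lemma measurable_mixture G : measurable_fun setT (mixture f G).
Proof.
have /choice[F] : forall k, exists F : {m & (('I_m -> Omega) * (Omega ->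
  'I_m))%type},
    (forall a, measurable ((tagged F).2 @^-1` [set a] : set (borel Omega))) /\
    forall t, ball ((tagged F).1 ((tagged F).2 t)) (k.+1%:R^-1 : R) t.
  move=> k; have [||m [s [c [mc sc]]]] := @finite_step _ _
      (fun t => ball t (k.+1%:R^-1 : R)) cptOmega.
  - by move=> t; exact: metric_ball_open.
  - by move=> t; exact: ballxx.
  - by exists (existT _ m (s, c)).
move=> /all_and2[mF bF].
pose a k y := \sum_(i < tag (F k))
  fine (G ((tagged (F k)).2 @^-1` [set i])) * f ((tagged (F k)).1 i) y.
apply: (@measurable_fun_cvg _ _ _ setT a) => [k|y _].
  by apply: measurable_sum => i; exact: measurable_funM.
apply/cvgrPdist_le => e e0.
apply: filterS (compact_unif_continuous cptOmega (@f_cont y) e0) => k ke.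
have [i1 i2] := Rintegral_step G (fun i => f ((tagged (F k)).1 i) y) (mF k).
rewrite /a -i2 /mixture -RintegralB//; last exact: density_integrable.
apply: integral_bound => [|t].
  apply: measurable_funB;
    first exact: (borel_continuous_measurable (@f_cont y)).
  by have /measurable_int/measurable_EFinP := i1.
by rewrite distrC ltW// ke.
Qed.

Lemma Rintegral_dirac (t : Omega) (h : Omega -> R) :
  measurable_fun [set: borel Omega] h ->
    \int[dirac (t : borel Omega)]_u h u = h t.
Proof.
move=> mh; rewrite /Rintegral integral_dirac ?diracT ?mul1e//.
exact/measurable_EFinP.
Qed.

Lemma mixture_dirac t y : mixture f (dirac (t : borel Omega)) y = f t y.
Proof. by apply: Rintegral_dirac; apply: borel_continuous_measurable;
  exact: f_cont. Qed.

(** Pulls weakly open sets of probabilities back to open sets of parameters. *)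
Lemma dirac_weak_continuous : continuous
  (fun t : Omega => (dirac (t : borel Omega) : probability (borel Omega) R) :
     weak_probability Omega).
Proof.
move=> t; apply/weak_cvgP => g [_ cg].
have E u : \int[dirac (u : borel Omega)]_x g x = g u.
  by apply: Rintegral_dirac; exact: borel_continuous_measurable.
rewrite E -[X in X --> _]/((fun u => \int[dirac (u : borel Omega)]_x g x) @ t).
under eq_fun do rewrite E.
exact: cg.
Qed.

(** A finite distance excludes that exactly one argument is 0; if both are 0, the inequalities are
    trivial. *)
Lemma log_dist_lt (a b e : R) : 0 <= a -> 0 <= b ->
  (log_dist a b < e%:E)%E -> a <= expR e * b /\ b <= expR e * a.
Proof.
rewrite /log_dist => a0 b0; case: ifPn => [/eqP <-|ab].
  rewrite lte_fin => e0; have : 1 <= expR e by rewrite -expR0 ler_expR ltW.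
  by split; rewrite ler_peMl.
have [a00|aN] := eqVneq a 0.
  rewrite a00 in ab *; rewrite /= lexx; case: ifPn => [b00|].
    by move: ab; rewrite eq_le b0 b00.
  by rewrite /= .
have [b00|bN] := eqVneq b 0.
  rewrite b00 in ab *; rewrite /= lexx; case: ifPn => [a00|].
    by move: aN; rewrite eq_le a0 a00.
  by rewrite /= .
have {a0 aN}a0 : 0 < a by rewrite lt_neqAle eq_sym aN.
have {b0 bN}b0 : 0 < b by rewrite lt_neqAle eq_sym bN.
rewrite !lne_EFin// -EFinB/= lte_fin => /ltW; rewrite ler_distl => /andP[h1 h2].
rewrite -{1}(lnK a0) -{2}(lnK b0) -{2}(lnK a0) -{1}(lnK b0) -!expRD !ler_expR.
by split; lra.
Qed.

(** * Local and finite domination of mixtures *)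

Hypothesis log_open :
  forall G0 (e M : R), 0 < e -> 0 < M ->
    open ([set G | (Lnorm mu +oo (fun y =>
      log_dist (trunc M (mixture f G y)) (trunc M (mixture f G0 y)))
      < e%:E)%E] : set (weak_probability Omega)).

(** The norm of exponent [+oo] is an essential supremum only for a measure of positive total
    mass. *)
Let muT_gt0 : (0 < mu setT)%E.
Proof.
rewrite lt0e measure_ge0 andbT; apply/eqP => mu0.
have [_ _] := f_dens point; rewrite null_set_integral//.
  by move/eqP; rewrite eq_sym onee_eq0.
exact/measurable_EFinP.
Qed.

(** Mixtures take values in [[0, K]], so truncation at [max K 1] leaves them unchanged, and the
    essential supremum bound becomes an almost everywhere bound on ratios. *)
Lemma mixture_ratio G0 (e : R) : 0 < e ->
  exists V : set (weak_probability Omega), [/\ open V, V G0 &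
    forall G, V G -> {ae mu, forall y,
      mixture f G y <= expR e * mixture f G0 y /\
                                 mixture f G0 y <= expR e * mixture f G y}].
Proof.
move=> e0; have M0 : 0 < Num.max K 1 by rewrite lt_max ltr01 orbT.
have tr G y : trunc (Num.max K 1) (mixture f G y) = mixture f G y.
  have xM : mixture f G y <= Num.max K 1 by rewrite le_max mixture_le.
  rewrite /trunc (min_l xM) max_r// (le_trans _ (mixture_ge0 G y))//.
  by rewrite oppr_le0 ltW.
have := log_open G0 e0 M0.
set V := [set _ | _] => oV; exists V; split => // [|G].
  rewrite /V/= (_ : (fun y => _) = cst 0%E) ?Lnorm0 ?lte_fin//.
  by apply/funext => y; rewrite /log_dist eqxx.
rewrite /V/= unlock muT_gt0 => Ve.
apply: filterS (ess_sup_ge mu (abse \o (fun y =>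
  log_dist (trunc (Num.max K 1) (mixture f G y))
           (trunc (Num.max K 1) (mixture f G0 y))))) => y /= /le_lt_trans/(_
             Ve).
rewrite !tr => lt_e; apply: log_dist_lt;
  [exact: mixture_ge0|exact: mixture_ge0|].
by apply: le_lt_trans lt_e; exact: lee_abs.
Qed.

(** Dirac masses give the bound with a null set that depends on [t]. The null sets of a dense
    sequence are united, and continuity of the density in the parameter extends the bound to all of
    [O] outside that one null set. *)
Lemma density_ratio (t0 : Omega) (e : R) : 0 < e ->
  exists O : set Omega, [/\ open O, O t0 &
    {ae mu, forall y, forall t, O t ->
      f t y <= expR e * f t0 y /\ f t0 y <= expR e * f t y}].
Proof.
move=> e0; have [V [oV Vt0 Vae]] := mixture_ratio (dirac (t0 : borel Omega)) e0.
pose O := (fun t : Omega => (dirac (t : borel Omega) :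
  probability (borel Omega) R) :
     weak_probability Omega) @^-1` V.
have oO : open O by apply: open_comp oV => t _; exact: dirac_weak_continuous.
exists O; split => //.
have [D D_dense] := compact_dense_sequence cptOmega.
have DO n : {ae mu, forall y, O (D n) ->
    f (D n) y <= expR e * f t0 y /\ f t0 y <= expR e * f (D n) y}.
  have [ODn|ODn] := pselect (O (D n)); last by apply: aeW => y /ODn.
  by apply: filterS (Vae _ ODn) => y; rewrite !mixture_dirac.
apply: filterS (ae_foralln DO) => y Dy t Ot.
pose B := [set u | f u y <= expR e * f t0 y /\ f t0 y <= expR e * f u y].
have cB : closed B.
  have cef : continuous (fun u => expR e * f u y).
    by move=> u; apply: cvgM; [exact: cvg_cst|exact: f_cont].
  have /continuous_closedP c1 := @f_cont y; move/continuous_closedP in cef.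
  by apply: closedI; [exact: c1 (@closed_le _ _)|exact: cef (@closed_ge _ _)].
suff : closure B t by move/cB.
move=> U /=; rewrite nbhsE => -[W [oW Wt] WU].
have [n [Wn On]] : exists n, (W `&` O) (D n).
  by apply: D_dense; [exact: openI|exists t].
by exists (D n); split; [exact: Dy|exact: WU].
Qed.

(** The neighbourhoods of [density_ratio] are intersected with those where [g] varies by less than
    [e]; only finitely many centres, hence finitely many null sets, remain. *)
Lemma step_ratio (g : Omega -> R) (e : R) : continuous g -> 0 < e ->
  exists m (s : 'I_m -> Omega) (c : Omega -> 'I_m),
  [/\ forall a, measurable (c @^-1` [set a] : set (borel Omega)),
      forall t, `|g t - g (s (c t))| <= e &
      {ae mu, forall y, forall t, f t y <= expR e * f (s (c t)) y /\
                                  f (s (c t)) y <= expR e * f t y}].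
Proof.
move=> cg e0.
have /choice[W OE] := (fun t => density_ratio t e0).
pose O' t := W t `&` [set u | `|g t - g u| < e].
have [|t|m [s [c [mc sc]]]] := @finite_step _ _ O' cptOmega.
- move=> t; have [oO _ _] := OE t; apply: openI => //.
  have cn : continuous (fun u => `|g t - g u|).
    move=> u; apply: cvg_norm; apply: cvgB; [exact: cvg_cst|exact: cg].
  by move/continuousP: cn => /(_ _ (@open_lt R e)).
- by have [_ Ot _] := OE t; split => //=; rewrite subrr normr0.
exists m, s, c; split => // [t|].
  by have [_ /ltW] := sc t; rewrite distrC.
have : {ae mu, forall y, forall n (nm : (n < m)%N) t, W (s (Ordinal nm)) t ->
    f t y <= expR e * f (s (Ordinal nm)) y /\
      f (s (Ordinal nm)) y <= expR e * f t y}.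
  apply: ae_foralln => n; have [nm|nm] := pselect (is_true (n < m)%N);
    last first.
    by apply: aeW => y nm'; case: (nm nm').
  have [_ _ Oae] := OE (s (Ordinal nm)).
  by apply: filterS Oae => y Oy nm'; rewrite (bool_irrelevance nm' nm).
apply: filterS => y Oy t; have [Ot _] := sc t.
have := Oy _ (ltn_ord (c t)) t.
have -> : Ordinal (ltn_ord (c t)) = c t by exact: val_inj.
exact.
Qed.

(** As [mu] is not assumed sigma-finite, the integrals are not exchanged. The mixture is squeezed,
    up to factors [expR e], around a finite mixture [h] of integral 1, and [e] tends to 0. *)
Lemma integral_mixture G : (\int[mu]_y (mixture f G y)%:E = 1)%E.
Proof.
have mix0 y : (0 <= (mixture f G y)%:E)%E by rewrite lee_fin mixture_ge0.
have key (e : R) : 0 < e -> (\int[mu]_y (mixture f G y)%:E <= (expR e)%:E /\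
    1 <= (expR e)%:E * \int[mu]_y (mixture f G y)%:E)%E.
  move=> e0.
  have [m [s [c [mc _ cae]]]] :=
    @step_ratio (cst 0) e (@cst_continuous _ _ 0) e0.
  pose w a := fine (G (c @^-1` [set a])).
  pose h y := \sum_(a < m) w a * f (s a) y.
  have w0 a : 0 <= w a by exact: fine_ge0.
  have h0 y : 0 <= h y by apply: sumr_ge0 => a _; exact: mulr_ge0.
  have mh : measurable_fun setT h.
    by apply: measurable_sum => a; exact: measurable_funM.
  have hE y : h y = \int[G]_t f (s (c t)) y.
    by have [_ ->] := Rintegral_step G (fun a => f (s a) y) mc.
  have ih y : G.-integrable setT (EFin \o (fun t :
    borel Omega => f (s (c t)) y)).
    by have [] := Rintegral_step G (fun a => f (s a) y) mc.
  have w1 : \sum_(a < m) w a = 1 by exact: sum_step_weights.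
  have int_h : (\int[mu]_y (h y)%:E = 1)%E.
    rewrite /h; under eq_integral do rewrite -sumEFin.
    rewrite ge0_integral_sum//; last 2 first.
    - by move=> a; apply/measurable_EFinP; exact: measurable_funM.
    - by move=> a y _; rewrite lee_fin mulr_ge0.
    rewrite (eq_bigr (fun a => (w a)%:E)) ?sumEFin ?w1// => a _.
    under eq_integral do rewrite EFinM.
    rewrite ge0_integralZl//.
    - by have [_ _ ->] := f_dens (s a); rewrite mule1.
    - exact/measurable_EFinP.
    - by move=> y _; rewrite lee_fin.
    - by rewrite lee_fin.
  split.
    rewrite -[leRHS]mule1 -int_h -ge0_integralZl//; last 2 first.
    - exact/measurable_EFinP.
    - by move=> y _; rewrite lee_fin.
    apply: ae_ge0_le_integral => //.
    - by apply/measurable_EFinP; exact: measurable_mixture.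
    - by move=> y _; rewrite lee_fin mulr_ge0// expR_ge0.
    - by apply/measurable_EFinP; exact: measurable_funM.
    apply: filterS cae => y cy _; rewrite -EFinM lee_fin hE -RintegralZl//.
    apply: le_Rintegral => //; first exact: density_integrable.
      have [] := Rintegral_step G (fun a => expR e * f (s a) y) mc => //.
    by move=> t _; have [] := cy t.
  rewrite -int_h -ge0_integralZl//; last by apply/measurable_EFinP;
    exact: measurable_mixture.
  apply: ae_ge0_le_integral => //.
  - by move=> y _; rewrite lee_fin.
  - exact/measurable_EFinP.
  - by move=> y _; rewrite mule_ge0// lee_fin expR_ge0.
  - by apply/measurable_EFinP; apply: measurable_funM => //;
    exact: measurable_mixture.
  apply: filterS cae => y cy _; rewrite -EFinM lee_fin hE -RintegralZl//;
    last exact: density_integrable.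
  apply: le_Rintegral => //; last by move=> t _; have [] := cy t.
  apply: (@bounded_integrable _ _ _ G _ (expR e * K)) => [|t].
    by apply: measurable_funM => //;
      exact: (borel_continuous_measurable (@f_cont y)).
  by rewrite normrM ger0_norm ?expR_ge0// ler_pM2l ?expR_gt0.
have Ifin : (\int[mu]_y (mixture f G y)%:E)%E \is a fin_num.
  rewrite ge0_fin_numE ?integral_ge0//.
  by have [/le_lt_trans -> //] := key 1 ltr01; rewrite ltry.
rewrite -(fineK Ifin) in key *; set I := fine _ in key *.
(* The exponent [ln (1 + e)] turns the factor into [1 + e]. *)
have {}key (e : R) : 0 < e -> I <= 1 + e /\ 1 <= (1 + e) * I.
  move=> e0; have e1 : 0 < 1 + e by rewrite addr_gt0.
  have [] := key (ln (1 + e)); first by rewrite ln_gt0// ltrDl.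
  by rewrite lnK// -EFinM !lee_fin.
have I1 : I <= 1 by apply/ler_addgt0Pr => e /key[].
congr EFin; apply/eqP; rewrite eq_le I1/=; apply/ler_addgt0Pr => e e0.
have [_ /le_trans->//] := key e e0.
by rewrite mulrDl mul1r lerD2l ler_piMr// ltW.
Qed.

(* Rounding up the weights keeps the upper bound valid for every G while leaving
   only finitely many dominating mixtures. *)
Lemma finite_bracket (g : Omega -> R) (e : R) : bounded_continuous g -> 0 < e ->
  exists (J : finType) (H : J -> probability (borel Omega) R)
         (j : probability (borel Omega) R -> J),
    (forall G, `|\int[G]_t g t - \int[H (j G)]_t g t| <= e) /\
    {ae mu, forall y, forall G,
      mixture f G y <= expR e * mixture f (H (j G)) y}.
Proof.
move=> gbc e0; have [/bounded_fun_bound[B gB] cg] := gbc.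
have e20 : 0 < e / 2 by rewrite divr_gt0.
have [m [s [c [mc gs cae]]]] := step_ratio cg e20.
have B0 : 0 <= B by rewrite (le_trans _ (gB point)).
(* The factor [B + 1] makes one [N] serve twice: for the error [2 * m * B / N] in the integral of
   [g], and for [m / N <= e / 2] in the density bound. *)
have [N N0 mN] : exists2 N : nat,
  (0 < N)%N & 2 * m%:R * (B + 1) <= (e / 2) * N%:R.
  exists (Num.truncn (2 * m%:R * (B + 1) / (e / 2))).+1 => //.
  by rewrite [leRHS]mulrC -ler_pdivrMr// ltW// truncnS_gt.
have N0' : (0 : R) < N%:R by rewrite ltr0n.
pose w G a := fine (G (c @^-1` [set a])).
have w0 G a : 0 <= w G a by exact: fine_ge0.
have w1 G : \sum_(a < m) w G a = 1 by exact: sum_step_weights.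
have wle1 G a : w G a <= 1.
  by rewrite -(w1 G) (bigD1 a)//= lerDl sumr_ge0.
have kP G a : (Num.truncn (N%:R * w G a) < N.+1)%N.
  by rewrite ltnS truncn_le_nat -natr1 ltr_pwDr// ler_piMr// ler0n.
(* The weights used are [(k a).+1] over their sum: the successor rounds up the truncation. *)
pose kk G : {ffun 'I_m -> 'I_(N.+1)} := [ffun a => Ordinal (kP G a)].
pose sz (k : {ffun 'I_m -> 'I_(N.+1)}) := (\sum_(a < m) (k a).+1)%N.
(* The sum [sz k] vanishes only when there are no cells; the Dirac mass is a filler for that
   case. *)
have /choice[H HE] : forall k : {ffun 'I_m -> 'I_(N.+1)},
    exists H : probability (borel Omega) R, (0 < sz k)%N ->
    forall (h : Omega -> R) M, measurable_fun [set: borel Omega] h ->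
      (forall t, `|h t| <= M) ->
      \int[H]_t h t = \sum_(a < m) (k a).+1%:R / (sz k)%:R * h (s a).
  move=> k; have [sz0|sz0] := ltnP 0 (sz k); last by exists (dirac point).
  have [|H [_ HE]] := @discrete_probability _ _ (borel Omega) _
      (fun a => (k a).+1%:R / (sz k)%:R :
        R) s (fun a => divr_ge0 (ler0n _ _) (ler0n _ _)).
    by rewrite -mulr_suml -natr_sum mulfV// pnatr_eq0 -lt0n.
  by exists H.
have kkP G a : N%:R * w G a <= (kk G a).+1%:R <= N%:R * w G a + 1.
  have Nw0 : 0 <= N%:R * w G a by rewrite mulr_ge0// ler0n.
  rewrite ffunE/= ltW ?truncnS_gt//= -natr1 lerD2r.
  by rewrite truncn_le.
have NE G : N%:R = \sum_(a < m) N%:R * w G a by rewrite -mulr_sumr w1 mulr1.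
have NS G : (N <= sz (kk G))%N.
  rewrite -(ler_nat R) natr_sum (NE G).
  by apply: ler_sum => a _; have /andP[] := kkP G a.
have SN G : (sz (kk G) <= N + m)%N.
  rewrite -(ler_nat R) natr_sum natrD (NE G).
  rewrite -[X in _ + X%:R](card_ord m) -sumr_const -big_split/=.
  by apply: ler_sum => a _; have /andP[] := kkP G a.
have S0 G : (0 < sz (kk G))%N by exact: leq_trans (NS G).
exists _, H, kk; split=> [G|].
  have [i1 i2] := Rintegral_step G (fun a => g (s a)) mc.
  have ig : G.-integrable setT (EFin \o g) by exact: (@continuous_integrable _
    _ G).
  have h1 : `|\int[G]_t g t - \sum_(a < m) w G a * g (s a)| <= e / 2.
    rewrite /w -i2 -RintegralB//; apply: integral_bound => //.
    apply: measurable_funB; first exact: borel_continuous_measurable.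
    by have /measurable_int/measurable_EFinP := i1.
  have h2 : `|\sum_(a < m) w G a * g (s a) - \int[H (kk G)]_t g t| <= e / 2.
    rewrite (HE _ (S0 G) _ B)//; last exact: borel_continuous_measurable.
    rewrite -sumrB (le_trans (ler_norm_sum _ _ _))//.
    apply: (@le_trans _ _ (\sum_(a < m) (N%:R^-1 + w G a * (m%:R / N%:R)) * B)).
      apply: ler_sum => a _; rewrite -mulrBl normrM ler_pM//.
      exact: (rounded_weight N0 (w0 G a) (kkP G a)).
    rewrite -mulr_suml big_split/= sumr_const card_ord -mulr_suml w1 mul1r.
    rewrite -[_ *+ m]mulr_natl.
    have -> : (m%:R * N%:R^-1 + m%:R / N%:R) * B = 2 * m%:R * B / N%:R by ring.
    rewrite ler_pdivrMr//.
    by rewrite (le_trans _ mN)// ler_wpM2l ?mulr_ge0 ?ler0n// lerDl.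
  rewrite [leRHS]splitr (le_trans _ (lerD h1 h2))//.
  by rewrite (le_trans _ (ler_normD _ _))// addrA subrK.
apply: filterS cae => y cy G.
have ih := density_integrable G y.
have [i1 i2] := Rintegral_step G (fun a => f (s a) y) mc.
rewrite /mixture (HE _ (S0 G) _ K)//;
  last exact: (borel_continuous_measurable (@f_cont y)).
have step1 : \int[G]_t f t y <= expR (e / 2) * \sum_(a < m) w G a * f (s a) y.
  rewrite /w -i2 -RintegralZl//; apply: le_Rintegral => //.
    have [] := Rintegral_step G (fun a => expR (e / 2) * f (s a) y) mc => //.
  by move=> t _; have [] := cy t.
rewrite (le_trans step1)// [in leRHS](splitr e) expRD -mulrA ler_wpM2l
  ?expR_ge0//.
rewrite mulr_sumr; apply: ler_sum => a _; rewrite mulrA ler_wpM2r//.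
have Sr0 : (0 : R) < (sz (kk G))%:R by rewrite ltr0n.
rewrite mulrA ler_pdivlMr//.
(* Half of the exponent was spent on the cells; the other half absorbs the excess of the rounded
   total over [N], via [1 + x <= expR x]. *)
have SE : (sz (kk G))%:R <= expR (e / 2) * N%:R :> R.
  apply: (@le_trans _ _ ((1 + e / 2) * N%:R)); last first.
    by rewrite ler_wpM2r ?ler0n// expR_ge1Dx.
  rewrite mulrDl mul1r (@le_trans _ _ (N%:R + m%:R))//.
    by rewrite -natrD ler_nat.
  rewrite lerD2l (le_trans _ mN)// mulrC mulrA mulrC -[leLHS]mulr1 ler_wpM2l
    ?ler0n//.
  lra.
rewrite (le_trans (ler_wpM2l (w0 G a) SE))// mulrC -mulrA ler_wpM2l ?expR_ge0//.
by have /andP[] := kkP G a.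
Qed.

Lemma le_affinity (G G' G0 G0' : probability (borel Omega) R) (e : R) :
  {ae mu, forall y, mixture f G y <= expR e * mixture f G0 y} ->
  {ae mu, forall y, mixture f G' y <= expR e * mixture f G0' y} ->
  (affinity mu (mixture f G) (mixture f G') <=
   (expR e)%:E * affinity mu (mixture f G0) (mixture f G0'))%E.
Proof.
move=> GG0 GG0'.
have mm H H' : measurable_fun setT (EFin \o (fun y => Num.sqrt (mixture f H y
  * mixture f H' y))).
  by apply/measurable_EFinP; apply: measurable_sqrt_mul;
    exact: measurable_mixture.
rewrite /affinity -ge0_integralZl//; last exact: mm.
apply: ae_ge0_le_integral => //.
- exact: mm.
- apply/measurable_EFinP; apply: measurable_funM => //.
  by apply: measurable_sqrt_mul; exact: measurable_mixture.
apply: filterS2 GG0 GG0' => y h1 h2 _; rewrite -EFinM lee_fin.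
rewrite -[expR e in leRHS](ger0_norm (expR_ge0 e)) -sqrtr_sqr -sqrtrM
  ?sqr_ge0//.
by rewrite ler_wsqrtr// expr2 mulrACA ler_pM ?mixture_ge0.
Qed.

(** * Uniform separation of mixtures by affinity *)

Hypothesis f_ident : identifiable mu f.

(** Compactness of the space of pairs makes a local bound uniform. Near a pair whose integrals
    differ by less than [eta] there is nothing to prove; near any other, identifiability gives an
    affinity below 1, and [mixture_ratio] keeps it below 1 on a neighbourhood. *)
Lemma affinity_modulus (g : Omega -> R) (eta : R) : bounded_continuous g ->
  0 < eta ->
  exists q : R, 0 <= q < 1 /\
    forall G G', eta <= `|\int[G]_t g t - \int[G']_t g t| ->
    (affinity mu (mixture f G) (mixture f G') <= q%:E)%E.
Proof.
move=> gbc eta0.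
pose X := (weak_probability Omega * weak_probability Omega)%type.
have cX : compact [set: X].
  rewrite -setXTT; apply: compact_setX; exact: weak_probability_compact.
pose int_g (G : weak_probability Omega) : R :=
  \int[(G : probability (borel Omega) R)]_t g t.
suff [n _ Hn] : \forall n \near \oo, forall x : X, setT x ->
    eta <= `|int_g x.1 - int_g x.2| ->
    (affinity mu (mixture f x.1) (mixture f x.2) <= (1 - n.+1%:R^-1)%:E)%E.
  exists (1 - n.+1%:R^-1); split.
    by rewrite subr_ge0 ltrBlDr ltrDl invr_gt0 ltr0n andbT invf_le1// ler1n.
  by move=> G G'; exact: (Hn n (leqnn n) (G, G') I).
move/compact_near_coveringP: cX; apply => -[G0 G0'] _.
have [lt_eta|le_eta] := ltP `|int_g G0 - int_g G0'| eta.
  have cI : continuous int_g := weak_integral_continuous gbc.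
  have cD : (fun x : X => `|int_g x.1 - int_g x.2|) @ (G0, G0')
      --> `|int_g G0 - int_g G0'|.
    apply: cvg_norm; apply: cvgB.
      apply: (@cvg_comp _ _ _ fst _ _ (nbhs G0)) (cI G0).
      exact: (@cvg_fst _ _ (nbhs G0) (nbhs G0')).
    apply: (@cvg_comp _ _ _ snd _ _ (nbhs G0')) (cI G0').
    exact: (@cvg_snd _ _ (nbhs G0) (nbhs G0')).
  exists ([set x : X | `|int_g x.1 - int_g x.2| < eta], setT).
    by split; [exact: (cvgr_lt _ cD)|exact: filterT].
  by case=> x n /= [xeta _]; rewrite leNgt xeta.
have nae : ~ {ae mu, forall y, mixture f G0 y = mixture f G0' y}.
  move=> /f_ident GE; move: le_eta.
  rewrite /int_g /Rintegral (@eq_measure_integral _ _ _ setT G0');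
    last by move=> A mA _; exact: GE.
  by rewrite subrr normr0 leNgt eta0.
have af1 : (affinity mu (mixture f G0) (mixture f G0') < 1)%E.
  exact: (affinity_lt1 (measurable_mixture _) (measurable_mixture _)
    (mixture_ge0 _) (mixture_ge0 _) (integral_mixture _) (integral_mixture _)).
have af0 : (0 <= affinity mu (mixture f G0) (mixture f G0'))%E.
  by apply: integral_ge0 => y _; rewrite lee_fin sqrtr_ge0.
set rho := affinity _ _ _ in af1 af0 *.
have /fineK rhoE : rho \is a fin_num by rewrite ge0_fin_numE// (lt_trans
  af1)// ltry.
set r := fine rho in rhoE; rewrite -rhoE !lte_fin !lee_fin in af0 af1.
(* The inflation factor [2 / (1 + r)] exceeds 1 because [r < 1], and its product with [r] is still
   below 1. *)
have e1 : 1 < 2 / (1 + r) by rewrite ltr_pdivlMr; lra.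
have e0 : 0 < ln (2 / (1 + r)) by rewrite ln_gt0.
have eE : expR (ln (2 / (1 + r))) = 2 / (1 + r) by rewrite lnK// posrE
  (lt_trans ltr01).
have [V [oV VG0 Vae]] := mixture_ratio G0 e0.
have [V' [oV' VG0' Vae']] := mixture_ratio G0' e0.
have q1 : 0 < 1 - 2 / (1 + r) * r.
  by rewrite subr_gt0 mulrAC ltr_pdivrMr; lra.
exists (V `*` V', [set n | n.+1%:R^-1 < 1 - 2 / (1 + r) * r]).
  split; last exact: (near_infty_natSinv_lt (PosNum q1)).
  by exists (V, V') => //; split; exact: open_nbhs_nbhs.
case=> -[G G'] n /= [[VG VG'] nq] _.
have h1 : {ae mu, forall y,
  mixture f G y <= expR (ln (2 / (1 + r))) * mixture f G0 y}.
  by apply: filterS (Vae _ VG) => y [].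
have h2 : {ae mu, forall y,
  mixture f G' y <= expR (ln (2 / (1 + r))) * mixture f G0' y}.
  by apply: filterS (Vae' _ VG') => y [].
rewrite (le_trans (le_affinity h1 h2))// eE -/rho -rhoE -EFinM lee_fin.
by rewrite lerBrDr -lerBrDl ltW.
Qed.

(** The maximizer has likelihood at least that of [Gn], and its likelihood is at most the product of
    the [c * b]; the square roots are removed by squaring the product. *)
Lemma gmle_likelihood_ratio n (y : 'I_n ->
  T) (Gh Gn : probability (borel Omega) R)
    (c : R) (b : T -> R) : is_gmle f y Gh -> 0 <= c -> (forall t, 0 <= b t) ->
  (forall i, 0 < mixture f Gn (y i)) ->
  (forall i, mixture f Gh (y i) <= c * b (y i)) ->
  1 <= \prod_i Num.sqrt (c * b (y i) / mixture f Gn (y i)).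
Proof.
move=> gm c0 b0 a0 bnd.
have pos : 0 <= \prod_i Num.sqrt (c * b (y i) / mixture f Gn (y i)).
  by apply: prodr_ge0 => i _; exact: sqrtr_ge0.
rewrite -(@expr_ge1 _ 2)// -prodrXl.
rewrite (eq_bigr (fun i => (c * b (y i)) / mixture f Gn (y i))); last first.
  by move=> i _; rewrite sqr_sqrtr// divr_ge0 ?mulr_ge0// ltW.
rewrite prodf_div ler_pdivlMr ?mul1r; last exact: prodr_gt0.
rewrite (le_trans (gm Gn))//; apply: ler_prod => i _.
by rewrite mixture_ge0 bnd.
Qed.

(** For a nonempty row the empirical measure is a probability and may compete with the maximizer. *)
Lemma empirical_probability n (theta : 'I_n.+1 -> Omega) :
  exists Gn : probability (borel Omega) R,
    (forall h : Omega -> R, \int[Gn]_t h t = \int[empirical theta]_t h t) /\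
    (forall y, mixture f Gn y = \sum_i n.+1%:R^-1 * f (theta i) y).
Proof.
have w0 (i : 'I_n.+1) : 0 <= n.+1%:R^-1 :> R by rewrite invr_ge0.
have [|Gn [GnA Gnh]] := @discrete_probability _ _ (borel Omega) _ _ theta w0.
  by rewrite sumr_const card_ord -[LHS]mulr_natl mulfV.
exists Gn; split=> [h|y]; last first.
  by rewrite /mixture (Gnh _ K)//;
    exact: (borel_continuous_measurable (@f_cont y)).
congr fine; apply: eq_measure_integral => A mA _.
by rewrite [LHS]GnA -ge0_sume_distrr.
Qed.

(** * The rows of observations and their maximizers *)

Context (theta : forall n : nat, 'I_n -> Omega) (dS : measure_display)
  (S : measurableType dS) (P : probability S R)
  (Y : forall n : nat, 'I_n -> {RV P >-> T}).
Arguments theta : clear implicits.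
Arguments Y : clear implicits.
Hypothesis Y_indep : forall n : nat, mutually_independent (Y n).
Hypothesis Y_dens : forall (n : nat) (i : 'I_n) (A : set T), measurable A ->
  distribution P (Y n i) A = (\int[mu]_(y in A) (f (theta n i) y)%:E)%E.
Arguments Y_indep : clear implicits.
Arguments Y_dens : clear implicits.
Context (Ghat : nat -> S -> probability (borel Omega) R).
Hypothesis Ghat_gmle : forall (n : nat) (w : S),
  is_gmle f (fun i => Y n i w) (Ghat n w).

(** The law of an observation is absolutely continuous with respect to [mu] and gives no mass to the
    zeros of its own density. *)
Lemma observation_ae n (i : 'I_n) (N : set T) : measurable N -> mu N = 0%E ->
  {ae P, forall w, ~ N (Y n i w) /\ 0 < f (theta n i) (Y n i w)}.
Proof.
move=> mN N0; pose Z := [set y | f (theta n i) y <= 0].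
have mZ : measurable Z.
  rewrite (_ : Z = f (theta n i) @^-1` `]-oo, 0]).
    by rewrite -[X in measurable X]setTI; exact: mf.
  by apply/seteqP; split => y /=; rewrite in_itv.
have mY (A : set T) : measurable A -> measurable (Y n i @^-1` A).
  by move=> mA; rewrite -[X in measurable X]setTI; exact: measurable_funP.
have PN : P (Y n i @^-1` N) = 0%E.
  have := Y_dens n i _ mN; rewrite /distribution/= /pushforward => ->.
  apply: null_set_integral => //; apply/measurable_EFinP;
    exact: measurable_funTS.
have PZ : P (Y n i @^-1` Z) = 0%E.
  have := Y_dens n i _ mZ; rewrite /distribution/= /pushforward => ->.
  apply: integral0_eq => y Zy; congr EFin.
  by apply/eqP; rewrite eq_le f_ge0 andbT.
exists (Y n i @^-1` N `|` Y n i @^-1` Z); split.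
- by apply: measurableU; exact: mY.
- by rewrite measureU0 //; exact: mY.
- move=> w /= /not_andP[/contrapT|/negP]; first by left.
  by rewrite -leNgt; right.
Qed.

Lemma gmle_near (g : Omega -> R) (eta : R) : bounded_continuous g -> 0 < eta ->
  {ae P, forall w, \forall n \near \oo,
    `|\int[Ghat n.+1 w]_t g t - \int[empirical (theta n.+1)]_t g t| < eta}.
Proof.
move=> gbc eta0; have eta20 : 0 < eta / 2 by rewrite divr_gt0.
have [q [/andP[q0 q1] aff]] := affinity_modulus gbc eta20.
have e1 : 1 < 2 / (1 + q) by rewrite ltr_pdivlMr; lra.
have le0 : 0 < ln (2 / (1 + q)) by rewrite ln_gt0.
(* The first bound leaves a distance of [eta / 2] after passing from the maximizer to its bracket;
   the second makes the rate [Q] smaller than 1. *)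
pose e := Num.min (eta / 2) (ln (2 / (1 + q))).
have e0 : 0 < e by rewrite lt_min eta20.
pose Q := Num.sqrt (expR e) * q.
have Q01 : 0 <= Q < 1.
  rewrite mulr_ge0 ?sqrtr_ge0//=.
  have ce : expR e <= 2 / (1 + q).
    by rewrite -[leRHS]lnK ?posrE ?(lt_trans ltr01)// ler_expR ge_min lexx orbT.
  have : Num.sqrt (expR e) <= expR e.
    rewrite -[leRHS]ger0_norm ?expR_ge0// -sqrtr_sqr ler_wsqrtr// expr2.
    by rewrite ler_peMr ?expR_ge0// -expR0 ler_expR ltW.
  move=> /le_trans/(_ ce) /(ler_wpM2r q0)/le_lt_trans; apply.
  by rewrite mulrAC ltr_pdivrMr; lra.
have [J [H [j [gH [N [mN N0 NP]]]]]] := finite_bracket gbc e0.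
(* Index [n] stands for row [n.+1], which sets the empty row aside. *)
have /choice[Gn /all_and2[GnE Gnf]] :=
  fun n => empirical_probability (theta n.+1).
pose bad n k := eta / 2 <= `|\int[H k]_t g t - \int[Gn n]_t g t|.
pose B n k := [set w | 1 <= \prod_i Num.sqrt (expR e *
    mixture f (H k) (Y n.+1 i w) / mixture f (Gn n) (Y n.+1 i w))].
have mB n k : measurable (B n k).
  exact: (measurable_likelihood_ratio (Y n.+1) (fun i => mf (theta n.+1 i))
    (fun i => f_ge0 (theta n.+1 i)) (expR e) (Gnf n) (measurable_mixture (H
      k))).
(* The event refers to the fixed [H k] rather than to the maximizer, so it is measurable however
   [Ghat] depends on [w]. *)
pose C n := \big[setU/set0]_(k | bad n k) B n k.
have mC n : measurable (C n) by apply: bigsetU_measurable => k _; exact: mB.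
have PB n k : bad n k -> (P (B n k) <= (Q ^+ n.+1)%:E)%E.
  move=> badk; have := likelihood_tail (Y_indep n.+1) (fun i => mf (theta n.+1
    i))
    (fun i => f_ge0 (theta n.+1 i)) (Y_dens n.+1) (Gnf n) (measurable_mixture
      (H k))
    (expR_ge0 e) (aff _ _ badk).
  exact.
have PC n : (P (C n) <= (#|J|%:R * Q ^+ n)%:E)%E.
  have [_ PCn] : measurable (C n) /\
    (P (C n) <= \sum_(k | bad n k) (Q ^+ n.+1)%:E)%E.
    rewrite /C; elim/big_rec2: _ => [|k x U badk [mU PU]].
      by split=> //; rewrite measure0.
    split; first exact: measurableU.
    by rewrite (le_trans (measureU2 _ _ _))// leeD// PB.
  rewrite (le_trans PCn)// sumEFin lee_fin sumr_const -[leLHS]mulr_natl.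
  have /andP[Q0 Q1] := Q01.
  apply: ler_pM; rewrite ?ler0n ?exprn_ge0// ?ler_nat ?max_card//.
  by rewrite exprS ler_piMl ?exprn_ge0// ltW.
have limC : P (lim_sup_set C) = 0%E.
  apply: lim_sup_set_cvg0 => //.
  by apply: (geometric_nneseries_lty (C := #|J|%:R) Q01) => // k.
have limC_ae : {ae P, forall w, ~ lim_sup_set C w}.
  exists (lim_sup_set C); split => //.
    apply: bigcapT_measurable => k; apply: bigcup_measurable => i _; exact: mC.
  by move=> w /= /contrapT.
have obs_ae : {ae P, forall w, forall n (i : 'I_n.+1),
    ~ N (Y n.+1 i w) /\ 0 < f (theta n.+1 i) (Y n.+1 i w)}.
  apply: ae_foralln => n; apply: ae_forall_ord => i; exact: observation_ae.
apply: filterS2 limC_ae obs_ae => w wC wN.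
have [n0 wn0] : exists n0, forall n, (n0 <= n)%N -> ~ C n w.
  apply: contrapT => /forallNP nC; apply: wC => n0 _.
  have [n /not_implyP[n0n /contrapT Cn]] := (existsNP _).2 (nC n0).
  by exists n.
exists n0 => // n /= n0n; rewrite ltNge; apply/negP => far.
apply: (wn0 n n0n).
(* Triangle inequality: the bracket of the maximizer is within [e <= eta / 2] of it, hence at least
   [eta / 2] away from the empirical integral. *)
have jbad : bad n (j (Ghat n.+1 w)).
  rewrite /bad GnE.
  have := gH (Ghat n.+1 w); have : e <= eta / 2 by rewrite ge_min lexx.
  have := ler_distD (\int[H (j (Ghat n.+1 w))]_t g t) (\int[Ghat n.+1 w]_t g t)
    (\int[empirical (theta n.+1)]_t g t).
  by move: far; lra.
rewrite /C (bigD1 (j (Ghat n.+1 w)))//=; left.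
apply: (gmle_likelihood_ratio (Ghat_gmle n.+1 w) (expR_ge0 e)
  (mixture_ge0 (H _))) => i.
  have [_ fi] := wN n i.
  rewrite Gnf (bigD1 i)//= ltr_pwDl ?mulr_gt0 ?invr_gt0//.
  by apply: sumr_ge0 => k _; rewrite mulr_ge0 ?invr_ge0.
(* [N] contains every point at which some bracket fails, and no observation lies in [N]. *)
have [Ni _] := wN n i; apply: contrapT => nle; apply: Ni.
by apply: NP => /(_ (Ghat n.+1 w)).
Qed.

End mixtures.

(** * Almost sure convergence of the integrals *)

Unset Implicit Arguments.

Theorem theorem4 (R : realType) (Omega : pmetricType R)
    (d : measure_display) (T : measurableType d)
    (mu : {measure set T -> \bar R}) (f : Omega -> T -> R)
    (f_dens : density_family mu f)
    (A1 : compact [set: Omega])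
    (A2 : (ereal_sup [set dens_expectation mu f t
                       (fun y => sup_abs_log f y ^+ 4) | t in [set: Omega]]
           < +oo)%E)
    (A3_bounded : exists K : R, forall t y, `|f t y| <= K)
    (A3_continuous : forall y, continuous (f ^~ y))
    (A4 : identifiable mu f)
    (A5 : forall (G0 : probability (borel Omega) R) (e M : R), 0 < e -> 0 < M ->
       open ([set G | (Lnorm mu +oo (fun y =>
                 log_dist (trunc M (mixture f G y)) (trunc M (mixture f G0 y)))
               < e%:E)%E] : set (weak_probability Omega)))
    (theta : forall n : nat, 'I_n -> Omega)
    (dS : measure_display) (S : measurableType dS) (P : probability S R)
    (Y : forall n : nat, 'I_n -> {RV P >-> T})
    (Y_indep : forall n : nat, mutually_independent (Y n))
    (Y_dens : forall (n : nat) (i : 'I_n) (A : set T), measurable A ->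
       distribution P (Y n i) A = (\int[mu]_(y in A) (f (theta n i) y)%:E)%E)
    (Ghat : nat -> S -> probability (borel Omega) R)
    (Ghat_gmle : forall (n : nat) (w : S),
       is_gmle f (fun i => Y n i w) (Ghat n w))
    (g : Omega -> R) (g_bc : bounded_continuous g) :
  {ae P, forall w,
     (fun n => \int[Ghat n w]_t g t - \int[empirical (theta n)]_t g t)
       @ \oo --> (0 : R)}.
Proof.
have [K f_le] := A3_bounded.
have inv0 k : (0 : R) < k.+1%:R^-1 by rewrite invr_gt0.
have key k := gmle_near f_dens A1 f_le A3_continuous A5 A4 Y_indep Y_dens
  Ghat_gmle g_bc (inv0 k).
(* The tolerances [1/(k+1)] are countable, so one null set serves them all. *)
apply: filterS (ae_foralln key) => w near_w.
(* The shift discards [n = 0], where the empirical measure is zero. *)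
rewrite -cvg_shiftS; apply/cvgrPdist_lt => e e0.
have [k _ ke] := near_infty_natSinv_lt (PosNum e0).
apply: filterS (near_w k) => n; rewrite sub0r normrN => /lt_trans; apply.
exact: (ke k (leqnn k)).
Qed.
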